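(* Let $(B_t,I_t)$ be independent Brownian motions under $\mathbb P^\ast$, and let $(X_t,D_t,\hat Y_t,\hat Q_t,\hat V_t)$, $t\in[0,T]$, be defined by the forward-backward SDE $$\mathrm{d}X_t=b(X_t)\,\mathrm{d}t+\sigma\,\mathrm{d}B_t,\quad X_0\sim\mu,$$ $$\mathrm{d}D_t=D_t\,\big(h(X_t)-\mathbb E_I^\ast[D_th(X_t)]\big)^{\rm T}\mathrm{d}I_t,\quad D_0=1,$$ $$\mathrm{d}\hat Y_t=\hat Q_t^{\rm T}\mathrm{d}B_t+\hat V_t^{\rm T}\big(\mathrm{d}I_t+\mathbb E_I^\ast[D_th(X_t)]\,\mathrm{d}t\big),\quad \hat Y_T=D_Tf(X_T).$$ Then the estimator $$\hat S_T^\pi[f]:=\hat Y_0-\int_0^T\hat U_t^{\rm T}\,\mathrm{d}Z_t$$ with this $\hat Y_0$ and control $\hat U_t=-\hat V_t$, $t\in[0,T]$, is unbiased, that is, $$\mathbb E_I^\ast\big[\hat S_T^\pi[f]\big]=\pi_T[f].$$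
   Context: State $X_t\in\mathbb R^n$, innovation process $I_t\in\mathbb R^m$, $T>0$ fixed, $b:\mathbb R^n\to\mathbb R^n$, $h:\mathbb R^n\to\mathbb R^m$, $\sigma>0$ a scalar, $\mu$ the initial distribution of $X_0$ ($X_0$ is independent of the Brownian motions). The observable $f:\mathbb R^n\to\mathbb R$ is deterministic. $\mathbb P^\ast$ (expectation $\mathbb E^\ast$) is the path measure of the mean-field forward system for $(X_t,D_t)$, driven by the independent standard Brownian motions $B_t$ (in $\mathbb R^n$) and $I_t$ (in $\mathbb R^m$). Notation: $\mathbb E_I^\ast[\,\cdot\,]$ of a quantity at time $t$ means conditional expectation $\mathbb E^\ast[\,\cdot\mid I_{0:t}]$; in particular $\mathbb E_I^\ast[\hat S_T^\pi[f]]=\mathbb E^\ast[\hat S_T^\pi[f]\mid I_{0:T}]$. The filtering distribution $\pi_t$ (of $X_t$ given $Z_{0:t}$ in the model $\mathrm{d}X_t=b(X_t)\mathrm{d}t+\sigma\mathrm{d}B_t$, $\mathrm{d}Z_t=h(X_t)\mathrm{d}t+\mathrm{d}W_t$) is represented by $\pi_t[g]=\mathbb E_I^\ast[D_t\,g(X_t)]$. The observation process and the innovation process are related by $I_t=Z_t-\int_0^t\pi_s[h]\,\mathrm{d}s$, i.e. $\mathrm{d}Z_t=\mathrm{d}I_t+\mathbb E_I^\ast[D_th(X_t)]\,\mathrm{d}t$. Solutions of BSDEs are adapted to the forward filtration. Standing assumption: $b,h,f,\mu$ are sufficiently regular (smoothness and integrability) that the forward and backward SDEs are well posed and the stochastic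 integrals that occur are true (square-integrable) martingales. *)

(* Defs.v *)
From HB Require Import structures.
From mathcomp Require Import all_boot all_order all_algebra.
From mathcomp Require Import all_classical all_reals all_analysis.
Set Implicit Arguments.
Unset Strict Implicit.
Unset Printing Implicit Defensive.
Import Order.TTheory GRing.Theory Num.Theory.
Import numFieldNormedType.Exports.
Local Open Scope classical_set_scope.
Local Open Scope ring_scope.

(* R^k is k.-tuple R, the library's measurable product of k copies of R (its
   sigma-algebra is generated by the coordinates, i.e. it is the Borel one).
   Processes are indexed by t : R; only their values on [0, T] matter. *)

Section vectors.
Context {R : realType} (k : nat).

Definition dotp (u v : k.-tuple R) : R := \sum_(j < k) tnth u j * tnth v j.
Definition subv (u v : k.-tuple R) : k.-tuple R :=
  [tuple tnth u j - tnth v j | j < k].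
Definition scalev (a : R) (u : k.-tuple R) : k.-tuple R :=
  [tuple a * tnth u j | j < k].
Definition oppv (u : k.-tuple R) : k.-tuple R := [tuple - tnth u j | j < k].
Definition zerov : k.-tuple R := [tuple 0 | j < k].

End vectors.

(* The events {W_s in A}, s <= t: a generating system, not yet a sigma-algebra.
   S is a sample space, or the space of paths with W the coordinate process. *)
Definition history {R : realType} {d'} {V : measurableType d'} {S : Type}
    (W : R -> S -> V) (t : R) : set (set S) :=
  \bigcup_(s in `[0, t]) preimage_set_system setT (W s) measurable.

Definition measurable_wrt {S : Type} {d'} {V : measurableType d'}
    (G : set (set S)) (Y : S -> V) : Prop :=
  preimage_set_system setT Y measurable `<=` G.

Section probability_space.
Context {R : realType} {d} {Omega : measurableType d} (P : probability Omega R).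

(* The sigma-algebra generated by G and the P-null sets. *)
Definition augment (G : set (set Omega)) : set (set Omega) :=
  <<s G `|` [set N | measurable N /\ P N = 0%E] >>.

(* Mutual independence of sigma-algebras; since each G j contains setT, the
   product rule for full families covers all subfamilies. *)
Definition mutually_independent (J : finType) (G : J -> set (set Omega)) :=
  forall A : J -> set Omega, (forall j, G j (A j)) ->
    P (\bigcap_(j in [set: J]) A j) = (\prod_(j : J) P (A j))%E.

(* Y is (a version of) E[X | G]. *)
Definition is_cexp (G : set (set Omega)) (X Y : Omega -> R) : Prop :=
  [/\ P.-integrable setT (EFin \o X),
      P.-integrable setT (EFin \o Y),
      measurable_wrt G Y &
      forall A, G A -> (\int[P]_(w in A) (Y w)%:E = \int[P]_(w in A) (X w)%:E)%E].

Definition adapted {d'} {V : measurableType d'} (F : R -> set (set Omega))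
    (T : R) (H : R -> Omega -> V) : Prop :=
  forall t, 0 <= t <= T -> measurable_wrt (F t) (H t).

Definition jointly_measurable {d'} {V : measurableType d'} (T : R)
    (H : R -> Omega -> V) : Prop :=
  measurable_fun (`[0, T] `*` setT) (fun p : R * Omega => H p.1 p.2).

Record brownian (T : R) (k : nat) (W : R -> Omega -> k.-tuple R) : Prop := {
  bm_measurable : forall t, 0 <= t <= T -> measurable_fun setT (W t);
  bm_zero : {ae P, forall w, W 0 w = zerov k};
  bm_continuous : {ae P, forall w, forall j : 'I_k,
    {within `[0, T], continuous (fun t => tnth (W t w) j)}};
  bm_gaussian : forall s t, 0 <= s -> s < t -> t <= T ->
    forall (j : 'I_k) (A : set R), measurable A ->
    P [set w | A (tnth (W t w) j - tnth (W s w) j)]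
      = normal_prob 0 (Num.sqrt (t - s)) A;
  bm_coordinates : forall s t, 0 <= s -> s < t -> t <= T ->
    mutually_independent (fun j : 'I_k => preimage_set_system setT
      (fun w => tnth (W t w) j - tnth (W s w) j) measurable);
  bm_increments : forall s t, 0 <= s -> s < t -> t <= T ->
    mutually_independent (tnth [tuple
      <<s history W s >>;
      preimage_set_system setT (fun w => subv (W t w) (W s w)) measurable]) }.

(* Simple integrands: sums over i < sp_len of c_i * 1_(lo_i, hi_i]. *)
Record simple_process (k : nat) := SimpleProcess {
  sp_len : nat;
  sp_lo : 'I_sp_len -> R;
  sp_hi : 'I_sp_len -> R;
  sp_coef : 'I_sp_len -> Omega -> k.-tuple R }.

Definition simple_admissible (F : R -> set (set Omega)) (T : R) (k : nat)
    (H : simple_process k) : Prop :=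
  forall i : 'I_(sp_len H),
    [/\ 0 <= sp_lo i, sp_lo i <= sp_hi i, sp_hi i <= T,
        measurable_wrt (F (sp_lo i)) (sp_coef i) &
        exists C : R, forall w j, `|tnth (sp_coef i w) j| <= C].

Definition simple_value (k : nat) (H : simple_process k) (t : R) (w : Omega)
    : k.-tuple R :=
  [tuple \sum_(i < sp_len H)
     (if sp_lo i < t <= sp_hi i then tnth (sp_coef i w) j else 0) | j < k].

Definition simple_integral (k : nat) (W : R -> Omega -> k.-tuple R)
    (H : simple_process k) (t : R) (w : Omega) : R :=
  \sum_(i < sp_len H) dotp (sp_coef i w)
     (subv (W (Num.min (sp_hi i) t) w) (W (Num.min (sp_lo i) t) w)).

(* E int_0^T |H_t|^2 dt *)
Definition energy (T : R) (k : nat) (H : R -> Omega -> k.-tuple R) : \bar R :=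
  (\int[P]_w \int[lebesgue_measure]_(t in `[0%R, T]) (dotp (H t w) (H t w))%:E)%E.

(* The (L^2) Ito integral: M_t = int_0^t H_s^T dW_s for all t in [0, T], as the
   L^2 limit of the integrals of simple processes that approximate H in
   L^2(dt x P). Each M_t is determined up to a P-null set. *)
Definition ito_integral (F : R -> set (set Omega)) (T : R) (k : nat)
    (W : R -> Omega -> k.-tuple R) (H : R -> Omega -> k.-tuple R)
    (M : R -> Omega -> R) : Prop :=
  [/\ jointly_measurable T H, adapted F T H, (energy T H < +oo)%E,
      adapted F T M &
      exists Hn : nat -> simple_process k,
        [/\ forall n, simple_admissible F T (Hn n),
            (fun n => energy T (fun t w => subv (simple_value (Hn n) t w) (H t w)))
              @ \oo --> 0%E &
            forall t, 0 <= t <= T ->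
              (fun n => \int[P]_w ((simple_integral W (Hn n) t w - M t w) ^+ 2)%:E)%E
                @ \oo --> 0%E]].

(* J_t = int_0^t U_s^T dZ_s for an Ito process dZ = dW + a dt. *)
Definition ito_process_integral (F : R -> set (set Omega)) (T : R) (k : nat)
    (W a : R -> Omega -> k.-tuple R) (U : R -> Omega -> k.-tuple R)
    (J : R -> Omega -> R) : Prop :=
  adapted F T J /\
  exists2 M, ito_integral F T W U M &
    forall t, 0 <= t <= T -> {ae P, forall w,
      lebesgue_measure.-integrable `[0, t] (fun s => (dotp (U s w) (a s w))%:E) /\
      J t w = M t w + \int[lebesgue_measure]_(s in `[0, t]) dotp (U s w) (a s w)}.

(* F_t = sigma(X_0, B_s, W_s : s <= t), augmented. *)
Definition forward_filtration (n k l : nat) (X0 : Omega -> n.-tuple R)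
    (B : R -> Omega -> k.-tuple R) (W : R -> Omega -> l.-tuple R) (t : R) :=
  augment (preimage_set_system setT X0 measurable `|` history B t `|` history W t).

(* sigma(W_s : s <= t), augmented. *)
Definition own_filtration (k : nat) (W : R -> Omega -> k.-tuple R) (t : R) :=
  augment (history W t).

(* X0 ~ mu, B and W are Brownian motions, and X0, B, W are independent. *)
Record driving_noise (T : R) (n k l : nat) (mu : probability (n.-tuple R) R)
    (X0 : Omega -> n.-tuple R) (B : R -> Omega -> k.-tuple R)
    (W : R -> Omega -> l.-tuple R) : Prop := {
  dn_X0_measurable : measurable_fun setT X0;
  dn_X0_law : forall A, measurable A -> P (X0 @^-1` A) = mu A;
  dn_brownian1 : brownian T B;
  dn_brownian2 : brownian T W;
  dn_independent : mutually_independent (tnth [tuple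
    preimage_set_system setT X0 measurable;
    <<s history B T >>; <<s history W T >>]) }.

(* dX = b(X) dt + sigma dB *)
Record signal_sde (F : R -> set (set Omega)) (T : R) (n : nat)
    (b : n.-tuple R -> n.-tuple R) (sigma : R)
    (B : R -> Omega -> n.-tuple R) (X : R -> Omega -> n.-tuple R) : Prop := {
  sde_adapted : adapted F T X;
  sde_continuous : {ae P, forall w, forall i : 'I_n,
    {within `[0, T], continuous (fun t => tnth (X t w) i)}};
  sde_integrable : {ae P, forall w, forall i : 'I_n,
    lebesgue_measure.-integrable `[0, T] (fun s => (tnth (b (X s w)) i)%:E)};
  sde_equation : {ae P, forall w, forall t, 0 <= t <= T -> forall i : 'I_n,
    tnth (X t w) i = tnth (X 0 w) i
      + \int[lebesgue_measure]_(s in `[0, t]) tnth (b (X s w)) i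
      + sigma * tnth (B t w) i} }.

(* Z_t = I_t + int_0^t a_s ds *)
Definition observation (k : nat) (I a : R -> Omega -> k.-tuple R)
    (t : R) (w : Omega) : k.-tuple R :=
  [tuple tnth (I t w) j + \int[lebesgue_measure]_(s in `[0, t]) tnth (a s w) j
    | j < k].

(* The mean-field forward system for (X, D); [hbar] is the process
   t |-> E[D_t h(X_t) | I_{0:t}], in a version that is measurable in (t, w). *)
Record forward_system (T : R) (n m : nat) (mu : probability (n.-tuple R) R)
    (b : n.-tuple R -> n.-tuple R) (h : n.-tuple R -> m.-tuple R) (sigma : R)
    (B : R -> Omega -> n.-tuple R) (I : R -> Omega -> m.-tuple R)
    (X : R -> Omega -> n.-tuple R) (D : R -> Omega -> R)
    (hbar : R -> Omega -> m.-tuple R) : Prop := {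
  fs_noise : driving_noise T mu (X 0) B I;
  fs_signal : signal_sde (forward_filtration (X 0) B I) T b sigma B X;
  fs_hbar_measurable : jointly_measurable T hbar;
  fs_hbar_cexp : forall t, 0 <= t <= T -> forall j : 'I_m,
    is_cexp (own_filtration I t)
      (fun w => D t w * tnth (h (X t w)) j) (fun w => tnth (hbar t w) j);
  fs_hbar_integrable : {ae P, forall w, forall j : 'I_m,
    lebesgue_measure.-integrable `[0, T] (fun s => (tnth (hbar s w) j)%:E)};
  fs_D_adapted : adapted (forward_filtration (X 0) B I) T D;
  fs_D_continuous : {ae P, forall w, {within `[0, T], continuous (D ^~ w)}};
  fs_D_equation : exists2 M : R -> Omega -> R,
    ito_integral (forward_filtration (X 0) B I) T I
      (fun t w => scalev (D t w) (subv (h (X t w)) (hbar t w))) M &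
    forall t, 0 <= t <= T -> {ae P, forall w, D t w = 1 + M t w} }.

(* dY = Q^T dB + V^T (dI + a dt), Y_T = xi, with (Y, Q, V) adapted. *)
Record bsde_solution (F : R -> set (set Omega)) (T : R) (n m : nat)
    (B : R -> Omega -> n.-tuple R) (I a : R -> Omega -> m.-tuple R)
    (xi : Omega -> R) (Y : R -> Omega -> R)
    (Q : R -> Omega -> n.-tuple R) (V : R -> Omega -> m.-tuple R) : Prop := {
  bsde_adapted : adapted F T Y;
  bsde_continuous : {ae P, forall w, {within `[0, T], continuous (Y ^~ w)}};
  bsde_equation : exists2 MJ : (R -> Omega -> R) * (R -> Omega -> R),
    ito_integral F T B Q MJ.1 /\ ito_process_integral F T I a V MJ.2 &
    forall t, 0 <= t <= T ->
      {ae P, forall w, Y t w = Y 0 w + MJ.1 t w + MJ.2 t w};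
  bsde_terminal : {ae P, forall w, Y T w = xi w} }.

(* The filtering model: dX = b(X) dt + sigma dB, dZ = h(X) dt + dW. *)
Record filtering_model (T : R) (n m : nat) (mu : probability (n.-tuple R) R)
    (b : n.-tuple R -> n.-tuple R) (h : n.-tuple R -> m.-tuple R) (sigma : R)
    (B : R -> Omega -> n.-tuple R) (W : R -> Omega -> m.-tuple R)
    (X : R -> Omega -> n.-tuple R) (Z : R -> Omega -> m.-tuple R) : Prop := {
  fm_noise : driving_noise T mu (X 0) B W;
  fm_signal : signal_sde (forward_filtration (X 0) B W) T b sigma B X;
  fm_Z_measurable : forall t, 0 <= t <= T -> measurable_fun setT (Z t);
  fm_h_integrable : {ae P, forall w, forall j : 'I_m,
    lebesgue_measure.-integrable `[0, T] (fun s => (tnth (h (X s w)) j)%:E)};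
  fm_observation : {ae P, forall w, forall t, 0 <= t <= T -> forall j : 'I_m,
    tnth (Z t w) j
      = \int[lebesgue_measure]_(s in `[0, t]) tnth (h (X s w)) j
        + tnth (W t w) j} }.

(* pi is the filtering distribution of X given Z, as a functional of the
   observed path: pi_t(z) depends on z_{0:t} only, and pi_t(Z)(A) is the
   conditional probability of X_t in A given Z_{0:t}. *)
Definition filtering_distribution (T : R) (n m : nat)
    (X : R -> Omega -> n.-tuple R) (Z : R -> Omega -> m.-tuple R)
    (pi : R -> (R -> m.-tuple R) -> probability (n.-tuple R) R) : Prop :=
  forall t, 0 <= t <= T -> forall A : set (n.-tuple R), measurable A ->
    measurable_wrt
      <<s history (fun s (z : R -> m.-tuple R) => z s) t >>
      (fun z => fine (pi t z A)) /\
    is_cexp (own_filtration Z t)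
      (fun w => \1_A (X t w)) (fun w => fine (pi t (Z ^~ w) A)).

(* The weighted law of X given I represents pi along Z:
   pi_t(Z)[g] = E[D_t g(X_t) | I_{0:t}]. *)
Definition filter_represented (T : R) (n m : nat)
    (I : R -> Omega -> m.-tuple R) (X : R -> Omega -> n.-tuple R)
    (D : R -> Omega -> R) (Z : R -> Omega -> m.-tuple R)
    (pi : R -> (R -> m.-tuple R) -> probability (n.-tuple R) R) : Prop :=
  forall t, 0 <= t <= T -> forall g : n.-tuple R -> R, measurable_fun setT g ->
    P.-integrable setT (fun w => (D t w * g (X t w))%:E) ->
    is_cexp (own_filtration I t)
      (fun w => D t w * g (X t w))
      (fun w => \int[pi t (Z ^~ w)]_x g x).

End probability_space.

(* Main.v *)
Require Import Defs.
From HB Require Import structures.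
From mathcomp Require Import all_boot all_order all_algebra.
From mathcomp Require Import all_classical all_reals all_analysis.
From mathcomp Require Import measurable_realfun ring lra.
Set Implicit Arguments.
Unset Strict Implicit.
Unset Printing Implicit Defensive.
Import Order.TTheory GRing.Theory Num.Theory.
Import numFieldNormedType.Exports.
Local Open Scope classical_set_scope.
Local Open Scope ring_scope.

(* The terminal condition of the BSDE gives, almost surely,
     Y_0 - J_T = D_T f(X_T) - M_T - (N_T + N'_T),
   where M = int Q^T dB, N = int V^T dI and N' = int U^T dI: the drift terms
   cancel because U = -V. By the representation of the filter,
   E[D_T f(X_T) | I] = pi_T[f], so two facts remain.
   - E[M_T | I] = 0: B is still a Brownian motion for the filtration enlarged by
     the whole path of I, so integrals of simple processes against B, hence
     their L^2 limits, integrate to 0 over every event of sigma(I_{0:T}).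
   - N_T + N'_T = 0: the sum is an L^2 limit of integrals of simple processes
     whose energy tends to 0, and the Ito isometry applies. *)

(** * Gaussian moments *)

(** [ito_integral] is a relation: M is the limit along some approximating sequence, and nothing ties
    the sequences of U and V together. Hence U = -V does not give N' = -N by definition, and this
    uniqueness statement is what calls for the isometry. The isometry is proved for finite families
    of possibly overlapping intervals, through the covariances of pairs of terms, so that the sum of
    two simple processes is a family of the same kind, without passing to a common partition.
    [brownian] controls increments only against the past of the process itself, whereas the
    integrands depend on X_0, B and I together. Independence allows X_0 and the whole path of one
    Brownian motion to enter the filtration of the other already at time 0. For B, conditioning on I
    becomes integration over events of time 0; for I, increments become independent of integrands
    that also depend on B. *)

Section gaussian.
Context {R : realType}.
Local Notation mu := (@lebesgue_measure R).
Implicit Types (m s : R).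

(** The change of variables formula provides only some density. It agrees with [normal_pdf] almost
    everywhere because both integrate to [normal_prob m s] over every measurable set. *)
Lemma ge0_integral_normal_prob m s (f : R -> \bar R) :
  measurable_fun setT f -> (forall x, 0 <= f x)%E ->
  (\int[normal_prob m s]_x f x = \int[mu]_x (f x * (normal_pdf m s x)%:E))%E.
Proof.
move=> mf f0; have dom := @normal_prob_dominates R m s.
rewrite -(Radon_Nikodym_SigmaFinite.change_of_variables dom)//.
have mr := measurable_int _ (Radon_Nikodym_SigmaFinite.f_integrable dom).
apply: ae_eq_integral => //.
- exact: emeasurable_funM.
- by apply: emeasurable_funM => //; apply/measurable_EFinP; exact: measurable_normal_pdf.
apply: ae_eqe_mul2l; apply: integral_ae_eq => //.
- exact: Radon_Nikodym_SigmaFinite.f_integrable.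
- by apply/measurable_EFinP; exact: measurable_normal_pdf.
- by move=> E _ mE; rewrite -Radon_Nikodym_SigmaFinite.f_integral.
Qed.

(** Lebesgue measure is invariant under reflection and the centred density is even. This symmetry
    later gives increments mean zero without computing an integral. *)
Lemma normal_prob0N s (A : set R) : s != 0 -> measurable A ->
  normal_prob 0 s (-%R @^-1` A) = normal_prob 0 s A.
Proof.
move=> s0 mA; rewrite /normal_prob.
have mp : measurable_fun setT (fun x : R => (normal_pdf 0 s x)%:E).
  by apply/measurable_EFinP; exact: measurable_normal_pdf.
transitivity (\int[pushforward mu (-%R : _ -> measurableTypeR R)]_(x in A)
    (normal_pdf 0 s x)%:E)%E; last first.
  by apply: eq_measure_integral => /= B mB _; exact: lebesgue_measureN.
rewrite ge0_integral_pushforward//.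
- apply: eq_integral => x _ /=; congr EFin.
  by rewrite !normal_pdfE// /normal_fun !subr0 sqrrN.
- exact: measurable_funTS.
- by move=> x _; rewrite lee_fin normal_pdf_ge0.
Qed.

(** Half of the exponential decay absorbs the square. With u = x^2 / (4 s^2), the integrand is x^2
    e^(-2u) = 4 s^2 (u e^(-u)) e^(-u) up to normalization; u <= e^u bounds it by 4 s^2 e^(-u), a
    multiple of the normal density with deviation sqrt 2 * s. *)
Lemma normal_prob0_sqr_lty s : s != 0 ->
  (\int[normal_prob 0 s]_x (x ^+ 2)%:E < +oo)%E.
Proof.
move=> s0; have s2 : 0 < s ^+ 2 by rewrite exprn_even_gt0.
have r0 : Num.sqrt 2 * s != 0 :> R by rewrite mulf_neq0// gt_eqF// sqrtr_gt0.
rewrite ge0_integral_normal_prob//; last 2 first.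
- by apply/measurable_EFinP; exact: measurable_funX.
- by move=> x; rewrite lee_fin sqr_ge0.
(* The quotient of peaks exchanges the normalization of the first density for that of the dominating
   one. *)
pose C := 4 * s ^+ 2 * normal_peak s / normal_peak (Num.sqrt 2 * s).
have C0 : 0 <= C.
  by rewrite /C divr_ge0 ?normal_peak_ge0// mulr_ge0 ?normal_peak_ge0// mulr_ge0// ltW.
apply: (@le_lt_trans _ _
    (\int[mu]_x (C%:E * (normal_pdf 0 (Num.sqrt 2 * s) x)%:E))%E); last first.
  rewrite integralZl//; last exact: integrable_normal_pdf.
  by rewrite integral_normal_pdf mule1 ltry.
apply: ge0_le_integral => //.
- by move=> x _; rewrite lee_fin mulr_ge0 ?sqr_ge0 ?normal_pdf_ge0.
- apply: emeasurable_funM => //; first by apply/measurable_EFinP; exact: measurable_funX.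
  by apply/measurable_EFinP; exact: measurable_normal_pdf.
- apply: emeasurable_funM => //.
  by apply/measurable_EFinP; exact: measurable_normal_pdf.
move=> x _; rewrite lee_fin !normal_pdfE// /C /normal_fun subr0.
rewrite [leRHS]mulrA divfK ?gt_eqF ?normal_peak_gt0//.
rewrite exprMn sqr_sqrtr//.
rewrite mulrCA [leRHS]mulrAC [leRHS]mulrC ler_wpM2l ?normal_peak_ge0//.
set u := x ^+ 2 / (4 * s ^+ 2).
have -> : x ^+ 2 = 4 * s ^+ 2 * u.
  by rewrite /u mulrC divfK// mulf_neq0 ?gt_eqF.
have -> : - (4 * s ^+ 2 * u) / (s ^+ 2 *+ 2) = - u - u.
  by rewrite /u; field.
have -> : - (4 * s ^+ 2 * u) / ((2 * s ^+ 2) *+ 2) = - u.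
  by rewrite -mulr_natr; field.
rewrite expRD -[leLHS]mulrA; apply: ler_wpM2l; first by rewrite mulr_ge0// sqr_ge0.
rewrite mulrA; apply: ler_piMl; first exact: expR_ge0.
rewrite expRN ler_pdivrMr ?expR_gt0// mul1r.
by apply: le_trans (expR_ge1Dx u); rewrite lerDr.
Qed.

(** Makes the second moment of an increment proportional to the elapsed time, with one universal
    constant. The substitution y = x / s is applied to the right-hand side. *)
Lemma normal_prob0_sqr_scale s : 0 < s ->
  (\int[normal_prob 0 s]_x (x ^+ 2)%:E =
   (s ^+ 2)%:E * \int[normal_prob 0 1]_x (x ^+ 2)%:E)%E.
Proof.
move=> s0; rewrite !ge0_integral_normal_prob//; last 4 first.
- by apply/measurable_EFinP; exact: measurable_funX.
- by move=> x; rewrite lee_fin sqr_ge0.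
- by apply/measurable_EFinP; exact: measurable_funX.
- by move=> x; rewrite lee_fin sqr_ge0.
have s'0 : s != 0 by rewrite gt_eqF.
pose G (y : R) := y ^+ 2 * normal_pdf 0 1 y.
pose F (x : R^o) : R^o := x * s^-1.
have F'E : F^`()%classic = cst s^-1.
  apply/funext => x; rewrite /F derive1E deriveM// derive_cst scaler0 add0r.
  by rewrite derive_id; exact: mulr1.
have cG : continuous G.
  move=> x; apply: cvgM; first exact: sqr_continuous.
  by apply: continuous_normal_pdf; rewrite oner_neq0.
have G0 x : 0 <= G x by rewrite mulr_ge0 ?sqr_ge0 ?normal_pdf_ge0.
under [in RHS]eq_integral do rewrite -EFinM -/(G _).
rewrite (@increasing_ge0_integration_by_substitutionT _ F G)//.
- rewrite -ge0_integralZl//.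
  + apply: eq_integral => x _; rewrite -!EFinM F'E; congr EFin.
    rewrite !fctE /= /G /F !normal_pdfE ?oner_neq0// /normal_fun !subr0.
    have -> : normal_peak s = normal_peak 1 / s.
      rewrite /normal_peak expr1n mul1r -(mulrnAr (s ^+ 2)) sqrtrM ?sqr_ge0//.
      by rewrite sqrtr_sqr gtr0_norm// invfM mulrC.
    have -> : - x ^+ 2 / (s ^+ 2 *+ 2) = - (x / s) ^+ 2 / (1 ^+ 2 *+ 2).
      by rewrite expr1n; field.
    by field.
  + apply/measurable_EFinP; rewrite F'E; apply: measurable_funM => //.
    apply: measurableT_comp; first exact: continuous_measurable_fun.
    exact: measurable_funM.
  + move=> x _; rewrite F'E lee_fin; apply: mulr_ge0; first exact: G0.
    by rewrite /= invr_ge0 ltW.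
  + by rewrite lee_fin sqr_ge0.
- by move=> x y xy; rewrite /F ltr_pM2r ?invr_gt0.
- by rewrite F'E => x; exact: cvg_cst.
- by rewrite F'E; exact: is_cvg_cst.
- by rewrite F'E; exact: is_cvg_cst.
- by apply/gt0_cvgMlNy; [rewrite invr_gt0|exact: cvg_id].
- by apply/gt0_cvgMly; [rewrite invr_gt0|exact: cvg_id].
Qed.

End gaussian.

(** * Real-valued random variables *)

Section integrable_reals.
Context {R : realType} {d} {Omega : measurableType d} (P : probability Omega R).
Local Notation integrable X := (P.-integrable setT (EFin \o X)).
Implicit Types X Y : Omega -> R.

Lemma integrable_measurable X : integrable X -> measurable_fun setT X.
Proof. by move=> /measurable_int/measurable_EFinP. Qed.

Lemma le_integrableR X Y : measurable_fun setT X ->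
  (forall w, `|X w| <= Y w) -> integrable Y -> integrable X.
Proof.
move=> mX XY iY; apply: le_integrable iY => //; first exact/measurable_EFinP.
by move=> w _ /=; rewrite lee_fin (le_trans (XY w))// ler_norm.
Qed.

Lemma integrableRD X Y : integrable X -> integrable Y ->
  integrable (fun w => X w + Y w).
Proof. by move=> iX iY; exact: (integrableD measurableT iX iY). Qed.

Lemma integrableRB X Y : integrable X -> integrable Y ->
  integrable (fun w => X w - Y w).
Proof. by move=> iX iY; exact: (integrableB measurableT iX iY). Qed.

Lemma integrableRZl c X : integrable X -> integrable (fun w => c * X w).
Proof. by move=> iX; exact: (integrableZl measurableT c iX). Qed.

Lemma integrableR_sum (I : Type) (r : seq I) (X : I -> Omega -> R) :
  (forall i, integrable (X i)) -> integrable (fun w => \sum_(i <- r) X i w).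
Proof.
move=> iX; rewrite (_ : _ \o _ = fun w => (\sum_(i <- r) (X i w)%:E)%E).
  by apply: (integrable_sum measurableT) => i _; exact: iX.
by apply/funext => w /=; rewrite sumEFin.
Qed.

Lemma Rintegral_sum (I : Type) (r : seq I) (X : I -> Omega -> R) :
  (forall i, integrable (X i)) ->
  \int[P]_w (\sum_(i <- r) X i w) = \sum_(i <- r) \int[P]_w X i w.
Proof.
move=> iX; elim: r => [|i r IH].
  by under eq_Rintegral do rewrite big_nil; rewrite Rintegral_cst// mul0r big_nil.
under eq_Rintegral do rewrite big_cons.
by rewrite RintegralD ?IH ?big_cons//; exact: integrableR_sum.
Qed.

Lemma integrable_bounded X Y (C : R) : measurable_fun setT X ->
  (forall w, `|X w| <= C) -> integrable Y -> integrable (fun w => X w * Y w).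
Proof.
move=> mX XC iY; apply: (@le_integrableR _ (fun w => C * `|Y w|)).
- by apply: measurable_funM => //; exact: integrable_measurable.
- by move=> w; rewrite normrM ler_wpM2r.
- by apply: integrableRZl; exact: integrable_norm.
Qed.

Lemma integrable_cst (c : R) : integrable (fun=> c).
Proof. exact: finite_measure_integrable_cst. Qed.

Lemma integrable_of_sqr X : measurable_fun setT X ->
  integrable (fun w => X w ^+ 2) -> integrable X.
Proof.
move=> mX iX2; apply: (@le_integrableR _ (fun w => 1 + X w ^+ 2)) => //.
  move=> w; rewrite -(real_normK (num_real (X w))).
  by have := sqr_ge0 (`|X w| - 1); nra.
by apply: integrableRD => //; exact: integrable_cst.
Qed.

Lemma integrable_mul_sqr X Y : measurable_fun setT X -> measurable_fun setT Y ->
  integrable (fun w => X w ^+ 2) -> integrable (fun w => Y w ^+ 2) ->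
  integrable (fun w => X w * Y w).
Proof.
move=> mX mY iX iY; apply: (@le_integrableR _ (fun w => X w ^+ 2 + Y w ^+ 2)).
- exact: measurable_funM.
- move=> w; rewrite ler_norml; apply/andP; split.
    by have := sqr_ge0 (X w + Y w); have := sqr_ge0 (X w); have := sqr_ge0 (Y w); nra.
  by have := sqr_ge0 (X w - Y w); have := sqr_ge0 (X w); have := sqr_ge0 (Y w); nra.
- exact: integrableRD.
Qed.

(** The product rule on rectangles identifies the joint law with the product of the two laws.
    Tonelli for |x y| then gives integrability, and Fubini the factorization. *)
Lemma integral_mul_indep X Y :
  (forall A B : set R, measurable A -> measurable B ->
    P (X @^-1` A `&` Y @^-1` B) = (P (X @^-1` A) * P (Y @^-1` B))%E) ->
  integrable X -> integrable Y ->
  integrable (fun w => X w * Y w) /\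
  \int[P]_w (X w * Y w) = (\int[P]_w X w) * (\int[P]_w Y w).
Proof.
move=> XY iX iY.
have mX := integrable_measurable iX; have mY := integrable_measurable iY.
have mZ : measurable_fun setT (fun w => (X w, Y w)) by exact: measurable_fun_pair.
pose X' : {mfun Omega >-> R} := HB.pack X (isMeasurableFun.Build _ _ _ _ _ mX).
pose Y' : {mfun Omega >-> R} := HB.pack Y (isMeasurableFun.Build _ _ _ _ _ mY).
pose Z' : {mfun Omega >-> (R * R)%type} :=
  HB.pack (fun w => (X w, Y w)) (isMeasurableFun.Build _ _ _ _ _ mZ).
have dE (C : set (R * R)) : measurable C ->
    (distribution P X' \x distribution P Y')%E C = distribution P Z' C.
  by move=> mC; apply: product_measure_unique => // A B mA mB; exact: XY.
have mp : measurable_fun setT (fun p : R * R => (p.1 * p.2)%:E).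
  by apply/measurable_EFinP; apply: measurable_funM.
have toP (f : R * R -> \bar R) : measurable_fun setT f -> (forall p, 0 <= f p)%E ->
    (\int[P]_w f (X w, Y w) =
     \int[distribution P X']_x \int[distribution P Y']_y f (x, y))%E.
  move=> mf f0; rewrite -fubini_tonelli1//.
  rewrite (eq_measure_integral (distribution P Z'))//; last by move=> *; exact: dE.
  by rewrite ge0_integral_distribution.
have mabs : measurable_fun setT (fun x : R => `|x|%:E).
  by apply/measurable_EFinP; exact: normr_measurable.
have absE (Z : {RV P >-> R}) :
    (\int[distribution P Z]_y `|y|%:E = \int[P]_w `|Z w|%:E)%E.
  exact: (ge0_integral_distribution Z mabs).
have abs_lty : (\int[P]_w `|(X w * Y w)%:E| < +oo)%E.
  rewrite (toP (fun p => `|(p.1 * p.2)%:E|)%E)//; last exact: (measurableT_comp _ mp).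
  under eq_integral => x _.
    under eq_integral do rewrite /= normrM EFinM.
    rewrite ge0_integralZl_EFin//.
    rewrite absE.
    over.
  move: iY => /integrableP[_ /=]; set c := integral _ _ _ => cy.
  have cfin : c \is a fin_num by rewrite ge0_fin_numE//; exact: integral_ge0.
  rewrite -(fineK cfin) ge0_integralZr//; last by rewrite lee_fin fine_ge0//; exact: integral_ge0.
  rewrite absE.
  by move: iX => /integrableP[_ /= xy]; apply: lte_mul_pinfty; [exact: integral_ge0|
    by rewrite ge0_fin_numE//; exact: integral_ge0|exact: ltry].
have iXY : integrable (fun w => X w * Y w).
  apply/integrableP; split => //.
  by apply/measurable_EFinP; exact: measurable_funM.
split=> //.
have mE : measurable_fun setT (fun x : R => x%:E) by exact/measurable_EFinP.
have iE (Z : {RV P >-> R}) : integrable Z ->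
    (distribution P Z).-integrable setT (fun x : R => x%:E).
  by move=> iZ; apply: integrable_pushforward.
have idE (Z : {RV P >-> R}) : integrable Z ->
    (\int[distribution P Z]_y y%:E = \int[P]_w (Z w)%:E)%E.
  by move=> iZ; exact: (integral_distribution mE).
rewrite -[RHS]/(fine _ * fine _) -fineM; last 2 first.
- exact: integrable_fin_num.
- exact: integrable_fin_num.
congr fine.
transitivity (\int[distribution P Z']_p (p.1 * p.2)%:E)%E.
  by rewrite (integral_distribution mp).
rewrite (eq_measure_integral (distribution P X' \x distribution P Y')%E); last first.
  by move=> C mC _; exact/esym/dE.
have imp : (distribution P X' \x distribution P Y')%E.-integrable setT
    (fun p : R * R => (p.1 * p.2)%:E).
  apply/integrableP; split => //.
  rewrite (eq_measure_integral (distribution P Z')); last first.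
    by move=> C mC _; exact: dE.
  rewrite (ge0_integral_distribution Z' (f := fun p => `|(p.1 * p.2)%:E|)%E)//.
  exact: (measurableT_comp _ mp).
rewrite -(integral12_prod_meas1 imp) /fubini_F/=.
under eq_integral => x _.
  under eq_integral do rewrite EFinM.
  rewrite integralZl//; last exact: (iE Y').
  rewrite (idE Y')//.
  over.
rewrite /=.
have YE : (\int[P]_w (Y w)%:E)%E \is a fin_num by exact: integrable_fin_num.
rewrite -(fineK YE) integralZr//; last exact: (iE X').
by rewrite (idE X').
Qed.

End integrable_reals.

(** * Independence of sigma-algebras *)

Section measurable_wrt_theory.
Context {S : pointedType} (G : set (set S)).
Hypothesis sG : sigma_algebra setT G.

(** Reads G as the sigma-algebra of a measurable type, so that the closure properties of measurable
    functions become available for [measurable_wrt]. *)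
Lemma measurable_wrtP {d'} {V : measurableType d'} (Y : S -> V) :
  measurable_wrt G Y <->
  measurable_fun setT (Y : g_sigma_algebraType G -> V).
Proof.
have GE : <<s G >> = G by exact: sigma_algebra_id.
split=> [GY _ B mB|mY _ [B mB <-]].
  by apply: sub_sigma_algebra; apply: GY; exists B.
by rewrite -GE; exact: (mY measurableT).
Qed.

End measurable_wrt_theory.

Lemma measurable_wrtM {R : realType} {S : pointedType} (G : set (set S))
    (X Y : S -> R) : sigma_algebra setT G ->
  measurable_wrt G X -> measurable_wrt G Y ->
  measurable_wrt G (fun w => X w * Y w).
Proof.
move=> sG /(measurable_wrtP sG) mX /(measurable_wrtP sG) mY.
by apply/(measurable_wrtP sG); exact: measurable_funM.
Qed.

Lemma measurable_wrtS {S : Type} {d'} {V : measurableType d'}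
    (G H : set (set S)) (Y : S -> V) :
  G `<=` H -> measurable_wrt G Y -> measurable_wrt H Y.
Proof. by move=> GH GY; exact: subset_trans GH. Qed.

Lemma measurable_wrt_measurable {d d'} {S : measurableType d}
    {V : measurableType d'} (G : set (set S)) (Y : S -> V) :
  G `<=` measurable -> measurable_wrt G Y -> measurable_fun setT Y.
Proof. by move=> Gm GY _ B mB; apply: Gm; apply: GY; exists B. Qed.

Lemma measurable_wrt_comp {S : Type} {d1 d2} {V1 : measurableType d1}
    {V2 : measurableType d2} (G : set (set S)) (Y : S -> V1) (f : V1 -> V2) :
  measurable_fun setT f -> measurable_wrt G Y -> measurable_wrt G (f \o Y).
Proof.
move=> mf GY _ [B mB <-]; apply: GY; exists (f @^-1` B).
  by rewrite -[_ @^-1` _]setTI; exact: mf.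
by [].
Qed.

Lemma measurable_subv {d} {S : measurableType d} {R : realType} k
    (f g : S -> k.-tuple R) :
  measurable_fun setT f -> measurable_fun setT g ->
  measurable_fun setT (fun w => subv (f w) (g w)).
Proof.
move=> mf mg; apply/measurable_fun_tnthP => j.
rewrite (_ : _ \o _ = fun w => tnth (f w) j - tnth (g w) j).
  by apply: measurable_funB; [exact: (measurable_fun_tnthP _).1|
    exact: (measurable_fun_tnthP _).1].
by apply/funext => w /=; rewrite tnth_mktuple.
Qed.

Section independence.
Context {R : realType} {d} {Omega : measurableType d} (P : probability Omega R).
Implicit Types G H : set (set Omega).

Definition indep_families G H :=
  forall A B, G A -> H B -> P (A `&` B) = (P A * P B)%E.

(** For a fixed B, the finite measures A |-> P (A [&] B) and A |-> P A * P B agree on the pi-system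
    G, which contains the whole space, hence on the sigma-algebra it generates. *)
Lemma indep_sigma G H : G `<=` measurable -> H `<=` measurable ->
  setI_closed G -> G setT -> indep_families G H -> indep_families <<s G >> H.
Proof.
move=> mG mH GI GT GH A B sA HB; have mB := mH _ HB.
have PB0 : 0 <= fine (P B) by exact: fine_ge0.
have PBE : (fine (P B))%:E = P B by rewrite fineK// fin_num_measure.
pose m2 := mscale (NngNum PB0) P.
have m2E C : m2 C = (P C * P B)%E by rewrite -PBE muleC.
rewrite -m2E.
apply: (@g_sigma_algebra_measure_unique _ _ _ G mG (fun=> setT) _ _ (mrestr P mB) m2) => //.
- by rewrite bigcup_const//; exists 0%N.
- by move=> C GC; transitivity (P C * P B)%E; [exact: GH|exact/esym/m2E].
- by move=> _; exact: (le_lt_trans (probability_le1 P (measurableI _ _ measurableT mB))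
    (ltry _)).
Qed.

Lemma augmentS G H : G `<=` H -> augment P G `<=` augment P H.
Proof. by move=> GH; apply: sub_sigma_algebra2; exact: setSU. Qed.

Lemma augment_measurable G : G `<=` measurable -> augment P G `<=` measurable.
Proof.
move=> mG; apply: smallest_sub; first exact: sigma_algebra_measurable.
by rewrite subUset; split => // N [].
Qed.

Lemma sub_augment G : G `<=` augment P G.
Proof. by move=> A GA; apply: sub_sigma_algebra; left. Qed.

Lemma augment_sigma_algebra G : sigma_algebra setT (augment P G).
Proof. exact: smallest_sigma_algebra. Qed.

(* A pi-system generating [augment P (G1 `|` G2 `|` G3)]: rectangles together
   with null sets. *)
Lemma indep_augment3 G1 G2 G3 H :
  [/\ G1 `<=` measurable, G2 `<=` measurable & G3 `<=` measurable] ->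
  H `<=` measurable ->
  [/\ setI_closed G1, setI_closed G2 & setI_closed G3] ->
  [/\ G1 setT, G2 setT & G3 setT] ->
  (forall A1 A2 A3 B, G1 A1 -> G2 A2 -> G3 A3 -> H B ->
    P (A1 `&` A2 `&` A3 `&` B) = (P (A1 `&` A2 `&` A3) * P B)%E) ->
  indep_families (augment P (G1 `|` G2 `|` G3)) H.
Proof.
move=> [m1 m2 m3] mH [I1 I2 I3] [T1 T2 T3] ind.
pose K : set (set Omega) := [set E | (exists A1 A2 A3,
  [/\ G1 A1, G2 A2, G3 A3 & E = A1 `&` A2 `&` A3]) \/
  (measurable E /\ P E = 0%E)].
have mK : K `<=` measurable.
  move=> E [[A1 [A2 [A3 [a1 a2 a3 ->]]]]|[]//].
  by apply: measurableI; [apply: measurableI; [exact: m1|exact: m2]|exact: m3].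
have null0 E F : measurable E -> measurable F -> P E = 0%E -> P (E `&` F) = 0%E.
  move=> mE mF PE; apply/eqP; rewrite eq_le measure_ge0 andbT -PE.
  by apply: le_measure; rewrite ?inE//; exact: measurableI.
have KK : augment P (G1 `|` G2 `|` G3) `<=` <<s K >>.
  apply: sub_sigma_algebra2 => E [[[g|g]|g]|g]; last by right.
  - by left; exists E, setT, setT; rewrite !setIT.
  - by left; exists setT, E, setT; rewrite setIT setTI.
  - by left; exists setT, setT, E; rewrite !setTI.
move=> A B /KK KA; apply: (indep_sigma (G := K)) => //.
- move=> E F KE KF; have mE := mK _ KE; have mF := mK _ KF.
  case: KE => [[A1 [A2 [A3 [a1 a2 a3 EE]]]]|[_ PE]]; last first.
    by right; split; [exact: measurableI|exact: null0].
  case: KF => [[B1 [B2 [B3 [b1 b2 b3 FE]]]]|[_ PF]]; last first.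
    by right; split; [exact: measurableI|rewrite setIC; exact: null0].
  left; exists (A1 `&` B1), (A2 `&` B2), (A3 `&` B3); split => //.
  - exact: I1. - exact: I2. - exact: I3.
  - by rewrite EE FE [in LHS]setIACA (setIACA A1).
- by left; exists setT, setT, setT; rewrite !setIT.
- move=> E F KE HF; case: (KE) => [[A1 [A2 [A3 [a1 a2 a3 ->]]]]|[mE PE]].
    exact: ind.
  by rewrite PE mul0e; apply: null0 => //; exact: mH.
Qed.

End independence.

(** * Brownian motion for an enlarged filtration *)

Lemma sigma_algebra_setI_closed {S : pointedType} (G : set (set S)) :
  setI_closed <<s G >>.
Proof.
move=> A B GA GB.
exact: (@measurableI _ (g_sigma_algebraType G) A B).
Qed.

Lemma preimage_set_system_setI_closed {S : Type} {d} {V : measurableType d}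
    (f : S -> V) : setI_closed (preimage_set_system setT f measurable).
Proof.
move=> _ _ [A mA <-] [B mB <-]; exists (A `&` B); first exact: measurableI.
by rewrite !setTI.
Qed.

Lemma preimage_set_systemT {S : Type} {d} {V : measurableType d} (f : S -> V) :
  preimage_set_system setT f measurable setT.
Proof. by exists setT => //; rewrite setTI. Qed.

Lemma preimage_set_system_sub {d d'} {S : measurableType d}
    {V : measurableType d'} (f : S -> V) : measurable_fun setT f ->
  preimage_set_system setT f measurable `<=` measurable.
Proof. by move=> mf _ [B mB <-]; exact: mf. Qed.

Lemma history_mono {R : realType} {d} {V : measurableType d} {S : Type}
    (W : R -> S -> V) (s t : R) : s <= t -> history W s `<=` history W t.
Proof.
move=> st; apply: bigcup_subset => u /=.
by rewrite !in_itv/= => /andP[-> us]; exact: le_trans st.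
Qed.

Section filtered_brownian.
Context {R : realType} {d} {Omega : measurableType d} (P : probability Omega R).

Lemma mutually_independent2 (G H : set (set Omega)) :
  mutually_independent P (tnth [tuple G; H]) -> indep_families P G H.
Proof.
move=> GH A B GA HB; have := GH (tnth [tuple A; B]).
have -> : \bigcap_(j in [set: 'I_2]) tnth [tuple A; B] j = A `&` B.
  apply/seteqP; split=> [w wAB|w [wA wB] [[|[|//]] ?] _] //.
  by split; [exact: (wAB ord0 I)|exact: (wAB (lift ord0 ord0) I)].
rewrite !big_ord_recl big_ord0 mule1; apply.
by move=> [[|[|//]] ?].
Qed.

Lemma mutually_independent3 (G1 G2 G3 : set (set Omega)) :
  mutually_independent P (tnth [tuple G1; G2; G3]) ->
  forall A1 A2 A3, G1 A1 -> G2 A2 -> G3 A3 ->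
  P (A1 `&` A2 `&` A3) = (P A1 * P A2 * P A3)%E.
Proof.
move=> GH A B C GA HB GC; have := GH (tnth [tuple A; B; C]).
have -> : \bigcap_(j in [set: 'I_3]) tnth [tuple A; B; C] j = A `&` B `&` C.
  apply/seteqP; split=> [w wAB|w [[wA wB] wC] [[|[|[|//]]] ?] _] //.
  split; first split.
  - exact: (wAB ord0 I).
  - exact: (wAB (lift ord0 ord0) I).
  - exact: (wAB (lift ord0 (lift ord0 ord0)) I).
rewrite !big_ord_recl big_ord0 mule1 muleA; apply.
by move=> [[|[|[|//]]] ?].
Qed.

(** In [brownian], increments are independent of the past of W alone. Integrands adapted to a larger
    filtration require independence from all of F s, which [fb_indep] states. *)
Record filtered_brownian (T : R) k (W : R -> Omega -> k.-tuple R)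
    (F : R -> set (set Omega)) : Prop := {
  fb_brownian : brownian P T W;
  fb_sigma : forall t, sigma_algebra setT (F t);
  fb_sub : forall t, t <= T -> F t `<=` measurable;
  fb_mono : forall s t, s <= t -> F s `<=` F t;
  fb_adapted : adapted F T W;
  fb_indep : forall s t, 0 <= s -> s < t -> t <= T ->
    indep_families P (F s) (preimage_set_system setT
      (fun w => subv (W t w) (W s w)) measurable) }.

Lemma history_measurable (T : R) k (W : R -> Omega -> k.-tuple R) (t : R) :
  brownian P T W -> t <= T -> history W t `<=` measurable.
Proof.
move=> bW tT A [s /=]; rewrite in_itv/= => /andP[s0 st].
apply: preimage_set_system_sub; apply: (bm_measurable bW).
by rewrite s0 (le_trans st).
Qed.

Lemma gen_history_measurable (T : R) k (W : R -> Omega -> k.-tuple R) (t : R) :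
  brownian P T W -> t <= T -> <<s history W t >> `<=` measurable.
Proof.
move=> bW tT; apply: smallest_sub; first exact: sigma_algebra_measurable.
exact: history_measurable tT.
Qed.

Lemma gen_history_increment (T : R) k (W : R -> Omega -> k.-tuple R) (s t : R) :
  0 <= s -> s <= t -> t <= T ->
  preimage_set_system setT (fun w => subv (W t w) (W s w)) measurable
    `<=` <<s history W T >>.
Proof.
move=> s0 st tT.
have mW u : 0 <= u -> u <= T ->
    measurable_fun setT (W u : g_sigma_algebraType (history W T) -> _).
  move=> u0 uT _ B mB; apply: sub_sigma_algebra; exists u.
    by rewrite /= in_itv/= u0.
  by exists B.
move=> _ [B mB <-].
apply: (@measurable_subv _ (g_sigma_algebraType (history W T))) => //.
- by apply: mW => //; exact: le_trans st.
- by apply: mW => //; exact: le_trans tT.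
Qed.

(** On a rectangle of events from G1, G2 and the past of W, joint independence splits off G1 and G2,
    and [bm_increments] splits the past of W from the increment. G1 and G2 belong to the filtration
    at every time, in particular at time 0. *)
Lemma enlarged_filtration (T : R) k (W : R -> Omega -> k.-tuple R)
    (G1 G2 : set (set Omega)) :
  brownian P T W ->
  G1 `<=` measurable -> G2 `<=` measurable ->
  setI_closed G1 -> setI_closed G2 -> G1 setT -> G2 setT ->
  (forall A1 A2 A3, G1 A1 -> G2 A2 -> <<s history W T >> A3 ->
    P (A1 `&` A2 `&` A3) = (P A1 * P A2 * P A3)%E) ->
  filtered_brownian T W (fun t => augment P (G1 `|` G2 `|` history W t)).
Proof.
move=> bW m1 m2 I1 I2 T1 T2 ind; split => //.
- by move=> t; exact: augment_sigma_algebra.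
- move=> t tT; apply: augment_measurable; rewrite !subUset; split => //.
  exact: history_measurable tT.
- by move=> s t st; apply: augmentS; apply: setUS; exact: history_mono.
- move=> t /andP[t0 tT] A WA; apply: sub_augment; right; exists t => //=.
  by rewrite in_itv/= t0 lexx.
- move=> s t s0 st tT; have sT : s <= T by rewrite ltW// (lt_le_trans st).
  have sub : <<s history W s >> `<=` <<s history W T >>.
    by apply: sub_sigma_algebra2; exact: history_mono.
  have subD := gen_history_increment s0 (ltW st) tT.
  have indI := mutually_independent2 (bm_increments bW s0 st tT).
  move=> A B FA HB.
  (* The generators [history W s] need not be stable under intersection, so they are replaced by the
     sigma-algebra that they generate; the last goal of this group restores the inclusion. *)
  apply: (@indep_augment3 _ _ _ P G1 G2 <<s history W s >>
    (preimage_set_system setT (fun w => subv (W t w) (W s w)) measurable)) => //.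
  + by split => //; exact: (gen_history_measurable bW).
  + by move=> C /subD; exact: (gen_history_measurable bW).
  + by split => //; exact: sigma_algebra_setI_closed.
  + by split => //; exact: (@measurableT _ (g_sigma_algebraType (history W s))).
  + move=> A1 A2 A3 C g1 g2 g3 HC; rewrite -setIA !ind//.
    * by rewrite indI// muleA.
    * exact: sub.
    * by apply: sigma_algebra_setI_closed; [exact: sub|exact: subD].
  + by apply: augmentS FA; apply: setUS; exact: sub_sigma_algebra.
Qed.

End filtered_brownian.

(** * Moments of Brownian increments *)

(* The value is 1, but only its finiteness is needed. *)
Definition normal_sqr_moment (R : realType) : R :=
  fine (\int[normal_prob 0 1]_x (x ^+ 2)%:E)%E.

Lemma normal_sqr_moment_ge0 (R : realType) : 0 <= normal_sqr_moment R.
Proof.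
by apply: fine_ge0; apply: integral_ge0 => x _; rewrite lee_fin sqr_ge0.
Qed.

Section increments.
Context {R : realType} {d} {Omega : measurableType d} (P : probability Omega R).
Context (T : R) (k : nat) (W : R -> Omega -> k.-tuple R) (F : R -> set (set Omega)).
Hypothesis fW : filtered_brownian P T W F.
Local Notation integrable X := (P.-integrable setT (EFin \o X)).
Local Notation "''EE' X" := (\int[P]_w X w) (at level 10, X at level 9).
Implicit Types (s t a b : R) (i j : 'I_k) (X Y : Omega -> R).

Definition increment s t j w : R := tnth (W t w) j - tnth (W s w) j.

Lemma increment_split s t u j w :
  increment s u j w = increment s t j w + increment t u j w.
Proof. by rewrite /increment; ring. Qed.

Lemma increment_id s j w : increment s s j w = 0.
Proof. exact: subrr. Qed.

Lemma increment_subv s t j w :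
  increment s t j w = tnth (subv (W t w) (W s w)) j.
Proof. by rewrite tnth_mktuple. Qed.

Lemma increment_adapted s t j : 0 <= s -> s <= t -> t <= T ->
  measurable_wrt (F t) (increment s t j).
Proof.
move=> s0 st tT; 
have mW u : 0 <= u -> u <= t ->
    measurable_fun setT (fun w : g_sigma_algebraType (F t) => tnth (W u w) j).
  move=> u0 ut; apply: (measurable_fun_tnthP _).1.
  apply/(measurable_wrtP (fb_sigma fW t)); apply: measurable_wrtS (fb_mono fW ut) _.
  by apply: (fb_adapted fW); rewrite u0 (le_trans ut).
apply/(measurable_wrtP (fb_sigma fW t)).
by apply: measurable_funB; apply: mW => //; exact: le_trans st.
Qed.

Lemma increment_measurable s t j : 0 <= s -> s <= t -> t <= T ->
  measurable_fun setT (increment s t j).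
Proof.
move=> s0 st tT; apply: measurable_wrt_measurable (fb_sub fW tT) _.
exact: increment_adapted.
Qed.

(** Stated for a function of the whole vector increment, so that it serves single coordinates and
    products of two coordinates alike. *)
Lemma increment_indep s t X (phi : k.-tuple R -> R) :
  0 <= s -> s < t -> t <= T ->
  measurable_wrt (F s) X -> integrable X -> measurable_fun setT phi ->
  integrable (fun w => phi (subv (W t w) (W s w))) ->
  integrable (fun w => X w * phi (subv (W t w) (W s w))) /\
  'EE (fun w => X w * phi (subv (W t w) (W s w))) =
    'EE X * 'EE (fun w => phi (subv (W t w) (W s w))).
Proof.
move=> s0 st tT FX iX mphi iphi; apply: integral_mul_indep => // A B mA mB.
apply: (fb_indep fW s0 st tT).
- by apply: FX; exists A; rewrite ?setTI.
- exists (phi @^-1` B); last by rewrite setTI.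
  by rewrite -[_ @^-1` _]setTI; exact: mphi.
Qed.

Section law.
Variables (s t : R) (j : 'I_k).
Hypotheses (s0 : 0 <= s) (st : s < t) (tT : t <= T).

Let mD : measurable_fun setT (increment s t j).
Proof. by apply: increment_measurable => //; exact: ltW. Qed.

Let D : {mfun Omega >-> measurableTypeR R} :=
  HB.pack (increment s t j : Omega -> measurableTypeR R)
    (isMeasurableFun.Build _ _ _ (measurableTypeR R) (increment s t j) mD).

Let lawD (A : set R) : measurable A ->
  distribution P D A = normal_prob 0 (Num.sqrt (t - s)) A.
Proof. exact: (bm_gaussian (fb_brownian fW)). Qed.

Let sd_gt0 : 0 < Num.sqrt (t - s).
Proof. by rewrite sqrtr_gt0 subr_gt0. Qed.

Lemma integral_sqr_increment :
  (\int[P]_w (increment s t j w ^+ 2)%:E =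
   ((t - s) * normal_sqr_moment R)%:E)%E.
Proof.
have msq : measurable_fun setT (fun x : measurableTypeR R => (x ^+ 2)%:E).
  by apply/measurable_EFinP; exact: measurable_funX.
have := @ge0_integral_distribution _ _ _ _ _ P D _ msq.
move=> <-; last by move=> x; rewrite lee_fin sqr_ge0.
rewrite (eq_measure_integral (normal_prob 0 (Num.sqrt (t - s)))); last first.
  by move=> A mA _; exact: lawD.
rewrite normal_prob0_sqr_scale// sqr_sqrtr ?subr_ge0 ?ltW//.
rewrite [RHS]EFinM /normal_sqr_moment fineK// ge0_fin_numE.
  by rewrite normal_prob0_sqr_lty// oner_neq0.
by apply: integral_ge0 => x _; rewrite lee_fin sqr_ge0.
Qed.

Lemma integrable_sqr_increment_lt : integrable (fun w => increment s t j w ^+ 2).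
Proof.
apply/integrableP; split.
  by apply/measurable_EFinP; exact: measurable_funX.
under eq_integral do rewrite /= ger0_norm ?sqr_ge0//.
by rewrite integral_sqr_increment ltry.
Qed.

(** By the symmetry of the centred normal law, the increment and its negative have the same law, so
    the mean equals its own negative. *)
Lemma integral_increment_lt : 'EE (increment s t j) = 0.
Proof.
have iD : integrable (increment s t j).
  by apply: integrable_of_sqr => //; exact: integrable_sqr_increment_lt.
have mN : measurable_fun setT (fun w => - increment s t j w).
  exact: measurable_funN.
pose N : {mfun Omega >-> measurableTypeR R} :=
  HB.pack (fun w => - increment s t j w : measurableTypeR R)
    (isMeasurableFun.Build _ _ _ (measurableTypeR R) _ mN).
have mid : measurable_fun setT (EFin : measurableTypeR R -> \bar R) by exact/measurable_EFinP.
have iN : integrable N.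
  by apply: eq_integrable (integrableRZl (-1) iD) => // w _ /=; rewrite mulN1r.
have : 'EE (fun w => - increment s t j w) = 'EE (increment s t j).
  congr fine.
  rewrite -(integral_distribution (X := N) mid)//.
  rewrite -(integral_distribution (X := D) mid)//.
  apply: eq_measure_integral => A mA _.
  rewrite [RHS]lawD// -normal_prob0N// ?gt_eqF// -lawD//.
  by rewrite -[_ @^-1` _]setTI; exact: oppr_measurable.
under eq_Rintegral do rewrite -mulN1r.
by rewrite RintegralZl// mulN1r; lra.
Qed.

End law.

Lemma integrable_sqr_increment s t j : 0 <= s -> s <= t -> t <= T ->
  integrable (fun w => increment s t j w ^+ 2).
Proof.
move=> s0; rewrite le_eqVlt => /predU1P[-> tT|st tT].
  rewrite (_ : (fun _ => _) = fun=> 0); first exact: integrable_cst.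
  by apply/funext => w; rewrite increment_id expr0n.
exact: integrable_sqr_increment_lt.
Qed.

Lemma integrable_increment s t j : 0 <= s -> s <= t -> t <= T ->
  integrable (increment s t j).
Proof.
move=> s0 st tT; apply: integrable_of_sqr; first exact: increment_measurable.
exact: integrable_sqr_increment.
Qed.

Lemma integral_increment2 s t i j : 0 <= s -> s < t -> t <= T ->
  'EE (fun w => increment s t i w * increment s t j w) =
  (i == j)%:R * ((t - s) * normal_sqr_moment R).
Proof.
move=> s0 st tT; have [->|ij] := eqVneq i j.
  rewrite mul1r /Rintegral; under eq_integral do rewrite -expr2.
  by rewrite integral_sqr_increment.
rewrite mul0r; have st' := ltW st.
suff ind (A B : set R) : measurable A -> measurable B ->
    P (increment s t i @^-1` A `&` increment s t j @^-1` B) =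
    (P (increment s t i @^-1` A) * P (increment s t j @^-1` B))%E.
  have [_ ->] := integral_mul_indep ind (integrable_increment i s0 st' tT)
    (integrable_increment j s0 st' tT).
  by rewrite integral_increment_lt// mul0r.
move=> mA mB.
(* Choosing the whole space at all other coordinates extracts pairwise independence from the product
   rule for the full family. *)
pose C l := if l == i then increment s t i @^-1` A
  else if l == j then increment s t j @^-1` B else setT.
have := bm_coordinates (fb_brownian fW) s0 st tT (A := C).
have -> : \bigcap_(l in [set: 'I_k]) C l =
    increment s t i @^-1` A `&` increment s t j @^-1` B.
  rewrite /C; apply/seteqP; split=> [w H|w [wA wB] l _].
    have := H i I; have := H j I.
    by rewrite !eqxx eq_sym (negbTE ij).
  by case: eqP => // _; case: eqP.
rewrite (bigD1 i)//= (bigD1 j)/=; last by rewrite eq_sym.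
rewrite big1 ?mule1.
  rewrite /C !eqxx (eq_sym j) (negbTE ij); apply => l.
  case: eqP => [->|_]; first by exists A; rewrite ?setTI.
  case: eqP => [->|_]; first by exists B; rewrite ?setTI.
  by exists setT; rewrite ?setTI.
move=> l /andP[li lj].
by rewrite /C (negbTE li) (negbTE lj) probability_setT.
Qed.

End increments.

(** * Covariances of weighted Brownian increments *)

Section pairs.
Context {R : realType} {d} {Omega : measurableType d} (P : probability Omega R).
Context (T : R) (k : nat) (W : R -> Omega -> k.-tuple R) (F : R -> set (set Omega)).
Hypothesis fW : filtered_brownian P T W F.
Local Notation integrable X := (P.-integrable setT (EFin \o X)).
Local Notation "''EE' X" := (\int[P]_w X w) (at level 10, X at level 9).
Local Notation inc := (increment W).
Implicit Types (s t a b : R) (i j : 'I_k) (X Y : Omega -> R).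

(** The martingale property in integrated form. The case s = t is separate because the laws in
    [brownian] concern s < t. *)
Lemma integral_mul_increment s t j X : 0 <= s -> s <= t -> t <= T ->
  measurable_wrt (F s) X -> integrable X ->
  'EE (fun w => X w * inc s t j w) = 0.
Proof.
move=> s0; rewrite le_eqVlt => /predU1P[-> tT FX iX|st tT FX iX].
  under eq_Rintegral do rewrite increment_id mulr0.
  by rewrite Rintegral_cst// mul0r.
under eq_Rintegral do rewrite increment_subv.
have st' := ltW st.
have imph : integrable (fun w => (fun u : k.-tuple R => tnth u j) (subv (W t w) (W s w))).
  apply: eq_integrable (integrable_increment fW j s0 st' tT) => // w _ /=.
  by rewrite increment_subv.
have [_ ->] := increment_indep fW s0 st tT FX iX (measurable_tnth j) imph.
under [X in _ * X]eq_Rintegral do rewrite -increment_subv.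
by rewrite (integral_increment_lt fW)// mulr0.
Qed.

Definition bounded_by (C : R) X := forall w, `|X w| <= C.

Lemma integrable_mul_increment2 s t s' t' i j X C :
  0 <= s -> s <= t -> t <= T -> 0 <= s' -> s' <= t' -> t' <= T ->
  measurable_fun setT X -> bounded_by C X ->
  integrable (fun w => X w * (inc s t i w * inc s' t' j w)).
Proof.
move=> s0 st tT s'0 st' tT' mX XC; apply: integrable_bounded XC _ => //.
apply: integrable_mul_sqr.
- exact: (increment_measurable fW).
- exact: (increment_measurable fW).
- exact: (integrable_sqr_increment fW).
- exact: (integrable_sqr_increment fW).
Qed.

Lemma integrable_bounded_by X C : measurable_fun setT X -> bounded_by C X ->
  integrable X.
Proof. by move=> mX XC; exact: (le_integrableR mX XC (integrable_cst P C)). Qed.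

Lemma integral_mul_increment2 s t i j X C : 0 <= s -> s <= t -> t <= T ->
  measurable_wrt (F s) X -> bounded_by C X ->
  'EE (fun w => X w * (inc s t i w * inc s t j w)) =
  (i == j)%:R * ((t - s) * normal_sqr_moment R) * 'EE X.
Proof.
move=> s0; rewrite le_eqVlt => /predU1P[-> tT FX XC|st tT FX XC].
  under eq_Rintegral do rewrite increment_id mul0r mulr0.
  by rewrite Rintegral_cst// subrr !(mul0r, mulr0).
have st' := ltW st; have sT : s <= T by exact: le_trans tT.
have mX := measurable_wrt_measurable (fb_sub fW sT) FX.
have iX := integrable_bounded_by mX XC.
pose phi (u : k.-tuple R) := tnth u i * tnth u j.
have mphi : measurable_fun setT phi.
  by apply: measurable_funM; exact: measurable_tnth.
have phiE w : phi (subv (W t w) (W s w)) = inc s t i w * inc s t j w.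
  by rewrite !increment_subv.
under eq_Rintegral do rewrite -phiE.
have imph : integrable (fun w => phi (subv (W t w) (W s w))).
  have := integrable_mul_increment2 i j s0 st' tT s0 st' tT
    (@measurable_cst _ _ _ _ setT (1 : R)) (C := 1) (fun=> _).
  move=> H; apply: eq_integrable (H _) => // [w _|w]; last by rewrite normr1.
  by rewrite /= phiE mul1r.
have [_ ->] := increment_indep fW s0 st tT FX iX mphi imph.
under [X in _ * X = _]eq_Rintegral do rewrite phiE.
by rewrite (integral_increment2 fW)// mulrC.
Qed.

(** Beyond the earlier endpoint, the longer increment is orthogonal to everything known by then;
    only the common stretch contributes. *)
Lemma integral_mul_increment_min s t t' i j X C :
  0 <= s -> s <= t -> t <= T -> s <= t' -> t' <= T ->
  measurable_wrt (F s) X -> bounded_by C X ->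
  'EE (fun w => X w * (inc s t i w * inc s t' j w)) =
  (i == j)%:R * ((Num.min t t' - s) * normal_sqr_moment R) * 'EE X.
Proof.
move=> s0; wlog tt' : t t' i j / t <= t'.
  move=> H st tT st' tT' FX XC; have /orP[tt'|tt'] := le_total t t'.
    exact: H FX XC.
  rewrite eq_sym minC -H//.
  by under eq_Rintegral do rewrite (mulrC (inc _ _ _ _)).
move=> st tT st' tT' FX XC; rewrite (min_idPl tt').
have sT := le_trans st tT.
have mX := measurable_wrt_measurable (fb_sub fW sT) FX.
under eq_Rintegral => w _.
  rewrite (increment_split _ s t t') mulrDr mulrDr.
  rewrite [X in _ + X]mulrA; over.
rewrite RintegralD//.
- rewrite (integral_mul_increment2 _ _ _ _ _ FX XC)//.
  rewrite integral_mul_increment ?addr0//; first exact: le_trans st.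
  + apply: measurable_wrtM; first exact: (fb_sigma fW).
      exact: measurable_wrtS (fb_mono fW st) FX.
    exact: (increment_adapted fW).
  + apply: integrable_bounded XC _ => //.
    exact: (integrable_increment fW).
- exact: integrable_mul_increment2 XC.
- have := integrable_mul_increment2 i j s0 st tT (le_trans s0 st) tt' tT' mX XC.
  by under eq_fun do rewrite mulrA.
Qed.

Definition overlap a b a' b' : R := Num.max 0 (Num.min b b' - Num.max a a').

(** Let a <= a' and cut the first interval at a'. What precedes a' is known when the second
    increment starts and contributes nothing; what remains starts at a' too, and both coefficients
    are known there. *)
Lemma integral_mul_pair a b a' b' i j c c' C C' :
  0 <= a -> a <= b -> b <= T -> 0 <= a' -> a' <= b' -> b' <= T ->
  measurable_wrt (F a) c -> bounded_by C c ->
  measurable_wrt (F a') c' -> bounded_by C' c' ->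
  'EE (fun w => (c w * inc a b i w) * (c' w * inc a' b' j w)) =
  (i == j)%:R * (overlap a b a' b' * normal_sqr_moment R) *
    'EE (fun w => c w * c' w).
Proof.
wlog aa' : a b a' b' i j c c' C C' / a <= a'.
  move=> H; have /orP[aa'|aa'] := le_total a a'; first exact: H.
  move=> a0 ab bT a0' ab' bT' Fc cC Fc' cC'.
  rewrite /overlap eq_sym (minC b) (maxC a).
  under [X in _ = _ * X]eq_Rintegral do rewrite mulrC.
  under eq_Rintegral do rewrite mulrC.
  by apply: H cC' _ cC.
move=> a0 ab bT a0' ab' bT' Fc cC Fc' cC'.
have aT := le_trans ab bT; have aT' := le_trans ab' bT'.
have mc := measurable_wrt_measurable (fb_sub fW aT) Fc.
have mc' := measurable_wrt_measurable (fb_sub fW aT') Fc'.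
have Fc2 := measurable_wrtS (fb_mono fW aa') Fc.
pose cc w := c w * c' w.
have Fcc : measurable_wrt (F a') cc.
  by apply: measurable_wrtM => //; exact: (fb_sigma fW).
have ccC : bounded_by (C * C') cc by move=> w; rewrite normrM ler_pM.
have mcc : measurable_fun setT cc by exact: measurable_funM.
under eq_Rintegral do rewrite mulrACA -/(cc _).
(* Used with u = b when the first interval ends before a', and with u = a' when it has to be cut. *)
have past u : a <= u -> u <= a' ->
    'EE (fun w => cc w * (inc a u i w * inc a' b' j w)) = 0.
  move=> au ua; under eq_Rintegral do rewrite mulrA.
  have uT := le_trans ua aT'.
  apply: integral_mul_increment => //.
  + apply: measurable_wrtM => //; first exact: (fb_sigma fW).
    apply: measurable_wrtS (fb_mono fW ua) _.
    exact: (increment_adapted fW).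
  + apply: integrable_bounded ccC _ => //.
    exact: (integrable_increment fW).
rewrite /overlap (max_idPr aa').
have /orP[ba'|a'b] := le_total b a'.
  rewrite past// (max_idPl _) ?mul0r ?mulr0 ?mul0r//.
  by rewrite subr_le0 ge_min ba'.
under eq_Rintegral do rewrite (increment_split _ a a' b) mulrDl mulrDr.
rewrite RintegralD//; last 2 first.
- exact: integrable_mul_increment2 ccC.
- exact: integrable_mul_increment2 ccC.
rewrite past// add0r (integral_mul_increment_min _ _ _ _ _ _ _ Fcc ccC)//.
by rewrite (max_idPr _)// subr_ge0 le_min a'b.
Qed.

End pairs.

(** * Isometry for simple integrands *)

(** The link between the two sides of the isometry: the covariance factor of two Brownian increments
    is also the time integral of the product of the indicators of their intervals. *)
Lemma lebesgue_overlap {R : realType} (T a b a' b' : R) :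
  0 <= a -> a <= b -> b <= T -> 0 <= a' -> a' <= b' -> b' <= T ->
  (\int[lebesgue_measure]_(t in `[0%R, T])
     (\1_(`]a, b] `&` `]a', b']) t)%:E = (overlap a b a' b')%:E)%E.
Proof.
move=> a0 ab bT a0' ab' bT'.
have mI : measurable (`]a, b] `&` `]a', b'] : set R).
  by apply: measurableI; exact: measurable_itv.
rewrite integral_indic//.
have -> : `]a, b] `&` `]a', b'] `&` `[0, T] =
    `](Num.max a a'), (Num.min b b')]%classic.
  apply/seteqP; split=> t /=; rewrite !in_itv/= gt_max le_min.
    by move=> [[/andP[-> ->] /andP[-> ->]] _].
  move=> /andP[/andP[at_ at_'] /andP[tb tb']]; rewrite at_ at_' tb tb'.
  by rewrite (le_trans a0 (ltW at_)) (le_trans tb bT).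
rewrite [LHS]lebesgue_measure_itv/= lte_fin /overlap -EFinB.
set M := Num.max a a'; set N := Num.min b b'; case: (ltP M N) => H.
  by rewrite (max_idPr _)// subr_ge0 ltW.
by rewrite (max_idPl _)// subr_le0.
Qed.

(* The index type is arbitrary so that two simple processes can be added by
   indexing over the sum of their index types. *)
Definition step_admissible {R : realType} {d} {Omega : measurableType d}
    (T : R) (F : R -> set (set Omega)) (k : nat) (J : Type) (lo hi : J -> R)
    (c : J -> Omega -> k.-tuple R) :=
  forall x, [/\ 0 <= lo x, lo x <= hi x, hi x <= T,
    measurable_wrt (F (lo x)) (c x) &
    exists C : R, forall w j, `|tnth (c x w) j| <= C].

Section isometry.
Context {R : realType} {d} {Omega : measurableType d} (P : probability Omega R).
Context (T : R) (k : nat) (W : R -> Omega -> k.-tuple R) (F : R -> set (set Omega)).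
Hypothesis fW : filtered_brownian P T W F.
Local Notation integrable X := (P.-integrable setT (EFin \o X)).
Local Notation "''EE' X" := (\int[P]_w X w) (at level 10, X at level 9).
Local Notation inc := (increment W).

Context (J : finType) (lo hi : J -> R) (c : J -> Omega -> k.-tuple R).
Hypothesis adm : step_admissible T F lo hi c.

Let lo_ge0 x : 0 <= lo x. Proof. by case: (adm x). Qed.
Let lo_hi x : lo x <= hi x. Proof. by case: (adm x). Qed.
Let hi_T x : hi x <= T. Proof. by case: (adm x). Qed.
Let c_adapted x : measurable_wrt (F (lo x)) (c x). Proof. by case: (adm x). Qed.
Let c_bounded x : exists C : R, forall w j, `|tnth (c x w) j| <= C.
Proof. by case: (adm x). Qed.

Let cj_adapted x j : measurable_wrt (F (lo x)) (fun w => tnth (c x w) j).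
Proof. exact: (measurable_wrt_comp (measurable_tnth j) (@c_adapted x)). Qed.

Let mcj x j : measurable_fun setT (fun w => tnth (c x w) j).
Proof.
have loT := le_trans (lo_hi x) (hi_T x).
exact: (measurable_wrt_measurable (fb_sub fW loT) (@cj_adapted x j)).
Qed.

Let cj_bounded x j : exists C, bounded_by C (fun w => tnth (c x w) j).
Proof. by have [C cC] := c_bounded x; exists C => w. Qed.

(** Indexing by interval and coordinate at once makes the integral a single sum of scalar terms,
    whose square expands over pairs of indices. *)
Let A (q : J * 'I_k) w := tnth (c q.1 w) q.2 * inc (lo q.1) (hi q.1) q.2 w.

Definition step_integral w := \sum_x dotp (c x w) (subv (W (hi x) w) (W (lo x) w)).

Definition step_value t w j :=
  \sum_x if lo x < t <= hi x then tnth (c x w) j else 0.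

Let step_integralE w : step_integral w = \sum_q A q w.
Proof.
rewrite /step_integral -(pair_bigA _ (fun x j => A (x, j) w))/=.
apply: eq_bigr => x _; apply: eq_bigr => j _.
by rewrite /A/= increment_subv.
Qed.

Let integrableAA q q' : integrable (fun w => A q w * A q' w).
Proof.
have [C cC] := cj_bounded q.1 q.2; have [C' cC'] := cj_bounded q'.1 q'.2.
pose X w := tnth (c q.1 w) q.2 * tnth (c q'.1 w) q'.2.
have XC : bounded_by (C * C') X by move=> w; rewrite normrM ler_pM.
have mX : measurable_fun setT X by apply: measurable_funM; exact: mcj.
have := integrable_mul_increment2 fW q.2 q'.2 (lo_ge0 q.1) (lo_hi q.1) (hi_T q.1)
  (lo_ge0 q'.1) (lo_hi q'.1) (hi_T q'.1) mX XC.
by under eq_fun do rewrite mulrACA.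
Qed.

Let cov x y j := 'EE (fun w => tnth (c x w) j * tnth (c y w) j).

Let AA q q' : 'EE (fun w => A q w * A q' w) =
  (q.2 == q'.2)%:R * (overlap (lo q.1) (hi q.1) (lo q'.1) (hi q'.1)
    * normal_sqr_moment R) * cov q.1 q'.1 q.2.
Proof.
have [C cC] := cj_bounded q.1 q.2; have [C' cC'] := cj_bounded q'.1 q'.2.
rewrite (integral_mul_pair fW q.2 q'.2 _ _ _ _ _ _ (@cj_adapted _ _) cC (@cj_adapted _ _) cC')//.
by have [->//|_] := eqVneq q.2 q'.2; rewrite !mul0r.
Qed.

Lemma integrable_sqr_step_integral : integrable (fun w => step_integral w ^+ 2).
Proof.
under eq_fun do rewrite step_integralE expr2 big_distrlr/=.
by apply: integrableR_sum => q; apply: integrableR_sum => q'.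
Qed.

Lemma measurable_step_integral : measurable_fun setT step_integral.
Proof.
rewrite (_ : step_integral = fun w => \sum_q A q w); last first.
  by apply/funext => w; rewrite step_integralE.
apply: measurable_sum => q; apply: measurable_funM; first exact: mcj.
exact: (increment_measurable fW).
Qed.

Lemma integrable_step_integral : integrable step_integral.
Proof.
apply: integrable_of_sqr; first exact: measurable_step_integral.
exact: integrable_sqr_step_integral.
Qed.

(** An event of F 0 is known at the start of every interval, so its indicator can be absorbed into
    the coefficients, which stay adapted and bounded; each term then vanishes by the martingale
    property. *)
Lemma integral_step_integral (E : set Omega) : F 0 E ->
  'EE (fun w => \1_E w * step_integral w) = 0.
Proof.
move=> FE; have EA q w : \1_E w * A q w =
    (\1_E w * tnth (c q.1 w) q.2) * inc (lo q.1) (hi q.1) q.2 w.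
  by rewrite mulrA.
have F1 t : 0 <= t -> measurable_wrt (F t) (\1_E : Omega -> R).
  move=> t0; apply/(measurable_wrtP (fb_sigma fW t)).
  apply: (@measurable_indic _ (g_sigma_algebraType (F t))).
  by apply: sub_sigma_algebra; exact: (fb_mono fW t0).
have loT x : lo x <= T := le_trans (lo_hi x) (hi_T x).
have iX q : measurable_wrt (F (lo q.1)) (fun w => \1_E w * tnth (c q.1 w) q.2) /\
    exists C, bounded_by C (fun w => \1_E w * tnth (c q.1 w) q.2).
  split.
    by apply: measurable_wrtM; [exact: (fb_sigma fW)|exact: F1|exact: cj_adapted].
  have [C cC] := cj_bounded q.1 q.2; exists C => w.
  rewrite normrM; apply: le_trans (cC w); rewrite ler_piMl// indicE.
  by case: (_ \in _); rewrite ?normr1 ?normr0.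
have mX q := measurable_wrt_measurable (fb_sub fW (loT q.1)) (iX q).1.
under eq_Rintegral do rewrite step_integralE mulr_sumr.
rewrite Rintegral_sum.
  apply: big1 => q _; under eq_Rintegral do rewrite EA.
  have [FX [C XC]] := iX q.
  apply: (integral_mul_increment fW) => //.
  exact: integrable_bounded_by XC.
move=> q; have [FX [C XC]] := iX q.
apply: eq_integrable (integrable_bounded (mX q) XC
  (integrable_increment fW q.2 (lo_ge0 q.1) (lo_hi q.1) (hi_T q.1))) => // w _ /=.
by rewrite EA.
Qed.

Let ov x y := overlap (lo x) (hi x) (lo y) (hi y).

Let step_sqr : 'EE (fun w => step_integral w ^+ 2) =
  normal_sqr_moment R * \sum_x \sum_y ov x y * \sum_j cov x y j.
Proof.
under eq_Rintegral do rewrite step_integralE expr2 big_distrlr/=.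
rewrite Rintegral_sum; last by move=> q; exact: integrableR_sum.
under eq_bigr => q _.
  rewrite Rintegral_sum//; under eq_bigr do rewrite AA.
  over.
rewrite -(pair_bigA _ (fun x j => \sum_q' (j == q'.2)%:R *
  (ov x q'.1 * normal_sqr_moment R) * cov x q'.1 j))/= mulr_sumr.
apply: eq_bigr => x _; rewrite mulr_sumr.
under eq_bigr => j _.
  rewrite -(pair_bigA _ (fun y j' => (j == j')%:R *
    (ov x y * normal_sqr_moment R) * cov x y j))/=.
  under eq_bigr => y _.
    rewrite (bigD1 j)//= eqxx mul1r big1 ?addr0; last first.
      by move=> j' jj'; rewrite eq_sym (negbTE jj') !mul0r.
    over.
  over.
rewrite exchange_big/=; apply: eq_bigr => y _.
by rewrite !mulr_sumr; apply: eq_bigr => j _; rewrite mulrA (mulrC (ov x y)).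
Qed.

Let inner w :
  (\int[lebesgue_measure]_(t in `[0%R, T]) (\sum_j step_value t w j ^+ 2)%:E =
   (\sum_x \sum_y ov x y * \sum_j tnth (c x w) j * tnth (c y w) j)%:E)%E.
Proof.
pose B x : set R := `]lo x, hi x]%classic.
pose e x y := \sum_j tnth (c x w) j * tnth (c y w) j.
(* In the expanded square, two interval indicators multiply to the indicator of the intersection,
   and the sum over coordinates collects into [e]. *)
have E t : \sum_j step_value t w j ^+ 2 =
    \sum_(p : J * J) e p.1 p.2 * \1_(B p.1 `&` B p.2) t.
  rewrite -(pair_bigA _ (fun x y => e x y * \1_(B x `&` B y) t))/=.
  under eq_bigr => j _ do rewrite /step_value expr2 big_distrlr/=.
  rewrite exchange_big; apply: eq_bigr => x _.
  rewrite exchange_big; apply: eq_bigr => y _.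
  rewrite /e mulr_suml; apply: eq_bigr => j _.
  rewrite indicI/= !indicE /B !mem_setE !in_itv/=.
  by case: ifP; case: ifP; rewrite ?(mulr0, mul0r, mulr1).
under eq_integral do rewrite E -sumEFin.
have mB p : measurable (B p.1 `&` B p.2).
  by apply: measurableI; exact: measurable_itv.
have iB p : lebesgue_measure.-integrable `[0, T] (fun t => (\1_(B p.1 `&` B p.2) t)%:E).
  apply/integrableP; split.
    apply/measurable_EFinP; apply: measurable_indic; exact: mB.
  under eq_integral do rewrite gee0_abs ?lee_fin//.
  by rewrite lebesgue_overlap// ltry.
under eq_integral do under eq_bigr do rewrite EFinM.
rewrite integral_sum//; last first.
  by move=> p; exact: integrableZl.
under eq_bigr => p _.
  rewrite integralZl// lebesgue_overlap// -EFinM mulrC -/(ov p.1 p.2). over.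
rewrite sumEFin -(pair_bigA _ (fun x y => ov x y * e x y))//.
Qed.

(** Both sides reduce to the same double sum over pairs of intervals, of overlap times covariance of
    coefficients: the left by orthogonality of increments ([step_sqr]), the right by integrating
    over time first ([inner]). *)
Lemma step_isometry :
  (\int[P]_w (step_integral w ^+ 2)%:E = (normal_sqr_moment R)%:E *
   \int[P]_w \int[lebesgue_measure]_(t in `[0%R, T])
     (\sum_j step_value t w j ^+ 2)%:E)%E.
Proof.
have icov x y j : integrable (fun w => tnth (c x w) j * tnth (c y w) j).
  have [C cC] := cj_bounded x j; have [C' cC'] := cj_bounded y j.
  apply: (@integrable_bounded_by _ _ _ P _ (C * C')); first by apply: measurable_funM; exact: mcj.
  by move=> w; rewrite normrM ler_pM.
under [X in (_ = _ * X)%E]eq_integral do rewrite inner.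
have iS := integrable_fin_num measurableT integrable_sqr_step_integral.
rewrite -(fineK iS) -[fine _]/('EE (fun w => step_integral w ^+ 2)) step_sqr.
set g := (X in (\int[P]_w X w)%E).
have ig : P.-integrable setT g.
  apply: integrableR_sum => x; apply: integrableR_sum => y.
  by apply: integrableRZl; exact: integrableR_sum.
have ig' := integrable_fin_num measurableT ig.
rewrite -(fineK ig') -EFinM; congr (_ * _)%:E.
rewrite -[RHS]/('EE (fun w =>
  \sum_x \sum_y ov x y * \sum_j tnth (c x w) j * tnth (c y w) j)).
rewrite Rintegral_sum; last first.
  move=> x; apply: integrableR_sum => y.
  by apply: integrableRZl; exact: integrableR_sum.
apply: eq_bigr => x _; rewrite Rintegral_sum; last first.
  by move=> y; apply: integrableRZl; exact: integrableR_sum.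
apply: eq_bigr => y _; rewrite RintegralZl//; last exact: integrableR_sum.
by rewrite Rintegral_sum.
Qed.

End isometry.

(** * Limits in mean square *)

Lemma cvge0_lt {R : realType} (u : nat -> \bar R) (e : R) :
  u @ \oo --> 0%E -> 0 < e ->
  exists N, forall n, (N <= n)%N -> (u n < e%:E)%E.
Proof.
move=> /fine_cvgP[[N1 _ fu] u0] e0.
have [N2 _ H] := @cvgr_lt R nat \oo _ _ _ u0 e e0.
exists (maxn N1 N2) => n; rewrite geq_max => /andP[n1 n2].
by rewrite -(fineK (fu n n1)) lte_fin; exact: H.
Qed.

Section l2_limits.
Context {R : realType} {d} {Omega : measurableType d} (P : probability Omega R).
Local Notation integrable X := (P.-integrable setT (EFin \o X)).
Local Notation "''EE' X" := (\int[P]_w X w) (at level 10, X at level 9).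
Implicit Types (X M : Omega -> R).

Lemma integrable_sqrP X : measurable_fun setT X ->
  integrable (fun w => X w ^+ 2) <-> (\int[P]_w (X w ^+ 2)%:E < +oo)%E.
Proof.
move=> mX; split=> [|H]; first exact: integrable_lty.
apply/integrableP; split; first by apply/measurable_EFinP; exact: measurable_funX.
by under eq_integral do rewrite /= ger0_norm ?sqr_ge0//.
Qed.

Lemma integral_L2_limit (S : nat -> Omega -> R) M (A : set Omega) :
  measurable A -> measurable_fun setT M ->
  (forall n, integrable (S n)) ->
  (forall n, 'EE (fun w => \1_A w * S n w) = 0) ->
  (fun n => \int[P]_w ((S n w - M w) ^+ 2)%:E)%E @ \oo --> 0%E ->
  integrable M /\ 'EE (fun w => \1_A w * M w) = 0.
Proof.
move=> mA mM iS S0 SM.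
have mS n := integrable_measurable (iS n).
have mD n : measurable_fun setT (fun w => S n w - M w) by exact: measurable_funB.
have iM : integrable M.
  have [n /(_ _ (leqnn n)) Hn] := cvge0_lt SM ltr01.
  have iD2 := (integrable_sqrP (mD n)).2 (lt_trans Hn (ltry 1)).
  apply: eq_integrable (integrableRB (iS n) (integrable_of_sqr (mD n) iD2)) => //.
  by move=> w _ /=; rewrite subKr.
split=> //; have i1 X : integrable X -> integrable (fun w => \1_A w * X w).
  move=> iX; apply: (@integrable_bounded _ _ _ P _ _ 1) => //.
  by move=> w; rewrite indicE; case: (_ \in _); rewrite ?normr1 ?normr0.
apply/eqP; rewrite -normr_le0; apply/ler_addgt0Pl => e e0; rewrite addr0.
have [n /(_ _ (leqnn n)) Hn] := cvge0_lt SM (exprn_gt0 2 (divr_gt0 e0 (@ltr0Sn R 1))).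
set dl := e / 2 in Hn; have dl0 : 0 < dl by rewrite divr_gt0.
have iD2 := (integrable_sqrP (mD n)).2 (lt_trans Hn (ltry _)).
have iD := integrable_of_sqr (mD n) iD2.
have -> : 'EE (fun w => \1_A w * M w) = - 'EE (fun w => \1_A w * (S n w - M w)).
  under [in RHS]eq_Rintegral do rewrite mulrBr.
  by rewrite RintegralB ?S0 ?sub0r ?opprK//; exact: i1.
rewrite normrN; apply: (le_trans (le_normr_Rintegral _ _)) => //; first exact: i1.
(* The bound |x| <= dl + x^2 / dl takes the place of Cauchy-Schwarz. As dl = e / 2 and the
   mean-square error is below dl^2, each of the two terms contributes at most e / 2. *)
pose bd w := dl + dl^-1 * (S n w - M w) ^+ 2.
have ibd : integrable bd.
  by apply: integrableRD; [exact: integrable_cst|exact: integrableRZl].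
apply: (@le_trans _ _ ('EE bd)).
  apply: le_Rintegral => //; first by apply: integrable_norm; exact: i1.
  move=> w _; rewrite normrM; apply: (@le_trans _ _ `|S n w - M w|).
    by rewrite ler_piMl// indicE; case: (_ \in _); rewrite ?normr1 ?normr0.
  rewrite /bd -(ler_pM2l dl0) mulrDr mulVKf ?gt_eqF//.
  rewrite -(real_normK (num_real (S n w - M w))).
  have := sqr_ge0 (`|S n w - M w| - dl); have := normr_ge0 (S n w - M w); nra.
rewrite RintegralD//; last 2 first.
- exact: integrable_cst.
- exact: integrableRZl.
rewrite Rintegral_cst//= probability_setT mulr1 RintegralZl//.
rewrite [leRHS](splitr e) lerD2l ler_pdivrMl// -expr2 -lee_fin.
rewrite /Rintegral fineK; first exact: ltW.
exact: integrable_fin_num.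
Qed.

End l2_limits.

(** * Iterated integrals over time and the sample space *)

Section iterated.
Context {R : realType} {d} {Omega : measurableType d} (P : probability Omega R).
Context (T : R).
Local Notation mu := (@lebesgue_measure R).
Implicit Types a b c : R -> Omega -> R.

Lemma measurable_section a w : jointly_measurable T a ->
  measurable_fun (`[0, T] : set R) (fun t => (a t w)%:E).
Proof.
move=> ma; apply/measurable_EFinP.
have mT : measurable (`[0, T] `*` setT : set (R * Omega)).
  by apply: measurableX => //; exact: measurable_itv.
apply: (@measurable_comp _ _ _ _ _ _ (`[0, T] `*` setT) (fun p => a p.1 p.2)
  _ (fun t => (t, w))) => //.
  by move=> _ [t tT <-].
by apply: measurable_funTS; exact: measurable_pair2.
Qed.

Lemma measurable_inner_integral a : (forall t w, 0 <= a t w) ->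
  jointly_measurable T a ->
  measurable_fun setT (fun w => \int[mu]_(t in `[0%R, T]) (a t w)%:E)%E.
Proof.
move=> a0 ma.
have mT : measurable (`[0, T] `*` setT : set (R * Omega)).
  by apply: measurableX => //; exact: measurable_itv.
(* Extension by zero outside the strip turns the integral over [0, T] into one over the whole line,
   where Tonelli gives measurability in w. *)
pose f := (fun p : R * Omega => (a p.1 p.2)%:E) \_ (`[0, T] `*` setT).
have mf : measurable_fun setT f.
  by apply/(measurable_restrictT _ mT); apply/measurable_EFinP.
have := @measurable_fun_fubini_tonelli_G _ _ (measurableTypeR R) Omega R mu f mf.
rewrite (_ : fubini_G mu f = fun w => (\int[mu]_(t in `[0%R, T]) (a t w)%:E)%E).
  apply=> p; rewrite /f patchE; case: ifP => // _; exact: a0.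
apply/funext => w; rewrite /fubini_G [RHS]integral_mkcond.
apply: eq_integral => t _; rewrite /f !patchE.
congr (if _ then _ else _); apply/idP/idP; rewrite !inE//=.
  by case.
Qed.

Lemma iterated_integral_le a b c :
  (forall t w, 0 <= a t w) -> (forall t w, 0 <= b t w) ->
  (forall t w, 0 <= c t w) ->
  jointly_measurable T a -> jointly_measurable T b -> jointly_measurable T c ->
  (forall t w, 0 <= t <= T -> c t w <= 2 * a t w + 2 * b t w) ->
  (\int[P]_w \int[mu]_(t in `[0%R, T]) (c t w)%:E <=
   2%:E * \int[P]_w \int[mu]_(t in `[0%R, T]) (a t w)%:E +
   2%:E * \int[P]_w \int[mu]_(t in `[0%R, T]) (b t w)%:E)%E.
Proof.
move=> a0 b0 c0 ma mb mc abc.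
have i0 e w : (forall t w, 0 <= e t w) ->
    (0 <= \int[mu]_(t in `[0%R, T]) (e t w)%:E)%E.
  by move=> e0; apply: integral_ge0 => t _; rewrite lee_fin.
rewrite -!ge0_integralZl//; last 4 first.
- exact: measurable_inner_integral.
- by move=> w _; exact: i0.
- exact: measurable_inner_integral.
- by move=> w _; exact: i0.
rewrite -ge0_integralD//; last 4 first.
- by move=> w _; rewrite mule_ge0// i0.
- by apply: emeasurable_funM => //; exact: measurable_inner_integral.
- by move=> w _; rewrite mule_ge0// i0.
- by apply: emeasurable_funM => //; exact: measurable_inner_integral.
apply: ge0_le_integral => //.
- by move=> w _; exact: i0.
- exact: measurable_inner_integral.
- apply: emeasurable_funD; apply: emeasurable_funM => //;
    exact: measurable_inner_integral.
move=> w _; rewrite -!ge0_integralZl//; last 4 first.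
- exact: measurable_section.
- by move=> t _; rewrite lee_fin.
- exact: measurable_section.
- by move=> t _; rewrite lee_fin.
rewrite -ge0_integralD//; last 4 first.
- by move=> t _; rewrite mule_ge0// lee_fin.
- by apply: emeasurable_funM => //; exact: measurable_section.
- by move=> t _; rewrite mule_ge0// lee_fin.
- by apply: emeasurable_funM => //; exact: measurable_section.
apply: ge0_le_integral => //.
- by move=> t _; rewrite lee_fin.
- exact: measurable_section.
- apply: emeasurable_funD; apply: emeasurable_funM => //;
    exact: measurable_section.
move=> t; rewrite /= in_itv/= => tT; rewrite -!EFinM -EFinD lee_fin.
exact: abc.
Qed.

End iterated.

(** * Ito integrals *)

Lemma integral_sqrD_le {R : realType} {d} {Omega : measurableType d}
    (P : probability Omega R) (X Y : Omega -> R) :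
  measurable_fun setT X -> measurable_fun setT Y ->
  (\int[P]_w ((X w + Y w) ^+ 2)%:E <=
   2%:E * \int[P]_w (X w ^+ 2)%:E + 2%:E * \int[P]_w (Y w ^+ 2)%:E)%E.
Proof.
move=> mX mY.
have mX2 : measurable_fun setT (fun w => (X w ^+ 2)%:E).
  by apply/measurable_EFinP; exact: measurable_funX.
have mY2 : measurable_fun setT (fun w => (Y w ^+ 2)%:E).
  by apply/measurable_EFinP; exact: measurable_funX.
have ge0 (Z : Omega -> R) w : (0 <= (Z w ^+ 2)%:E)%E by rewrite lee_fin sqr_ge0.
rewrite -!ge0_integralZl// -ge0_integralD//; last 4 first.
- by move=> w _; rewrite mule_ge0// lee_fin.
- exact: emeasurable_funM.
- by move=> w _; rewrite mule_ge0// lee_fin.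
- exact: emeasurable_funM.
apply: ge0_le_integral => //.
- by move=> w _; rewrite lee_fin sqr_ge0.
- by apply/measurable_EFinP; apply: measurable_funX; exact: measurable_funD.
- by apply: emeasurable_funD; exact: emeasurable_funM.
move=> w _; rewrite -!EFinM -EFinD lee_fin.
by have := sqr_ge0 (X w - Y w); nra.
Qed.

Section ito.
Context {R : realType} {d} {Omega : measurableType d} (P : probability Omega R).
Context (T : R) (k : nat) (W : R -> Omega -> k.-tuple R).
Context (F G : R -> set (set Omega)).
Hypothesis fW : filtered_brownian P T W F.
Hypothesis GF : forall t, 0 <= t <= T -> G t `<=` F t.
Hypothesis T0 : 0 <= T.
Local Notation integrable X := (P.-integrable setT (EFin \o X)).
Local Notation "''EE' X" := (\int[P]_w X w) (at level 10, X at level 9).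
Implicit Types (H K : @simple_process R d Omega k) (U V : R -> Omega -> k.-tuple R).

(** The integral is defined relative to G, while W is known to be Brownian relative to the larger F.
    Admissibility passes upward, so the moment computations take place in F. *)
Lemma simple_admissibleS H : simple_admissible G T H ->
  step_admissible T F (@sp_lo _ _ _ _ H) (@sp_hi _ _ _ _ H) (@sp_coef _ _ _ _ H).
Proof.
move=> aH i; have [l0 lh hT cG bc] := aH i; split => //.
apply: measurable_wrtS cG; apply: GF.
by rewrite l0 (le_trans lh).
Qed.

Lemma simple_integralE H : simple_admissible G T H -> simple_integral W H T =
  step_integral W (@sp_lo _ _ _ _ H) (@sp_hi _ _ _ _ H) (@sp_coef _ _ _ _ H).
Proof.
move=> aH; apply/funext => w; apply: eq_bigr => i _.
have [l0 lh hT _ _] := aH i.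
by rewrite (min_idPl hT) (min_idPl (le_trans lh hT)).
Qed.

Lemma ito_measurable U M : ito_integral P G T W U M -> measurable_fun setT (M T).
Proof.
move=> [_ _ _ aM _]; apply: measurable_wrt_measurable (fb_sub fW (lexx T)) _.
by apply: measurable_wrtS (aM T _); [apply: GF|]; rewrite T0 lexx.
Qed.

(** The event is taken from F 0 rather than G 0: when F is enlarged by an independent path, this
    allows conditioning on that whole path. *)
Lemma ito_integral_cond U M (A : set Omega) : F 0 A ->
  ito_integral P G T W U M ->
  integrable (M T) /\ 'EE (fun w => \1_A w * M T w) = 0.
Proof.
move=> FA iM; have mM := ito_measurable iM.
have [_ _ _ _ [Hn [aH _ lim]]] := iM.
have mA : measurable A by exact: (fb_sub fW T0).
apply: (@integral_L2_limit _ _ _ P (fun n => simple_integral W (Hn n) T)) => //.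
- move=> n; rewrite simple_integralE//.
  exact: (integrable_step_integral fW (simple_admissibleS (aH n))).
- move=> n; rewrite simple_integralE//.
  exact: (integral_step_integral fW (simple_admissibleS (aH n))).
- by apply: lim; rewrite T0 lexx.
Qed.

Lemma simple_value_measurable H : simple_admissible G T H ->
  forall j, measurable_fun (`[0, T] `*` setT)
    (fun p : R * Omega => tnth (simple_value H p.1 p.2) j).
Proof.
move=> aH j; apply: measurable_funTS.
rewrite (_ : (fun _ => _) = fun p : R * Omega => \sum_(i < sp_len H)
    (\1_(`]sp_lo i, sp_hi i] : set R) p.1 * tnth (sp_coef i p.2) j)).
  apply: measurable_sum => i; apply: measurable_funM.
    have mI : measurable (`]sp_lo i, sp_hi i] : set R) by exact: measurable_itv.
    have m1 : measurable_fun setT (\1_(`]sp_lo i, sp_hi i] : set R) : R -> R).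
      exact: measurable_indic.
    exact: (measurableT_comp m1).
  apply: (measurableT_comp (measurable_tnth j)).
  apply: measurableT_comp => //.
  have [_ _ _ ci _] := simple_admissibleS aH i.
  have loT : sp_lo i <= T by have [_ lh hT _ _] := aH i; exact: le_trans hT.
  exact: (measurable_wrt_measurable (fb_sub fW loT) ci).
apply/funext => p; rewrite tnth_mktuple; apply: eq_bigr => i _.
by rewrite indicE mem_setE in_itv/=; case: ifP; rewrite ?mul1r ?mul0r.
Qed.

Lemma sqr_subv_measurable (A B : R -> Omega -> k.-tuple R) :
  (forall j, measurable_fun (`[0, T] `*` setT)
    (fun p : R * Omega => tnth (A p.1 p.2) j)) ->
  jointly_measurable T B ->
  jointly_measurable T
    (fun t w => dotp (subv (A t w) (B t w)) (subv (A t w) (B t w))).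
Proof.
move=> mA mB; apply: measurable_sum => j.
have m : measurable_fun (`[0, T] `*` setT)
    (fun p : R * Omega => tnth (subv (A p.1 p.2) (B p.1 p.2)) j).
  rewrite (_ : (fun _ => _) =
      fun p : R * Omega => tnth (A p.1 p.2) j - tnth (B p.1 p.2) j).
    apply: measurable_funB; first exact: mA.
    exact: (measurableT_comp (measurable_tnth j) mB).
  by apply/funext => p; rewrite tnth_mktuple.
exact: measurable_funM.
Qed.

Lemma dotp_ge0 (u : k.-tuple R) : 0 <= dotp u u.
Proof. by apply: sumr_ge0 => j _; rewrite -expr2 sqr_ge0. Qed.

(** The disjoint union of the index sets presents H + K as one family of steps. Since U + V = 0, its
    value is (H - U) + (K - V), which is controlled by the two approximation errors. *)
Lemma simple_sum_isometry U V H K :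
  jointly_measurable T U -> jointly_measurable T V ->
  (forall t w, 0 <= t <= T -> U t w = oppv (V t w)) ->
  simple_admissible G T H -> simple_admissible G T K ->
  (\int[P]_w ((simple_integral W H T w + simple_integral W K T w) ^+ 2)%:E <=
   (normal_sqr_moment R)%:E *
     (2%:E * energy P T (fun t w => subv (simple_value H t w) (U t w)) +
      2%:E * energy P T (fun t w => subv (simple_value K t w) (V t w))))%E.
Proof.
move=> jU jV UV aH aK.
have sH := simple_admissibleS aH; have sK := simple_admissibleS aK.
pose lo x := match x with inl i => @sp_lo _ _ _ _ H i | inr i => @sp_lo _ _ _ _ K i end.
pose hi x := match x with inl i => @sp_hi _ _ _ _ H i | inr i => @sp_hi _ _ _ _ K i end.
pose c x := match x with inl i => @sp_coef _ _ _ _ H i | inr i => @sp_coef _ _ _ _ K i end.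
have adm : step_admissible T F lo hi c by case=> i; [exact: sH|exact: sK].
have SE w : simple_integral W H T w + simple_integral W K T w = step_integral W lo hi c w.
  by rewrite !simple_integralE// /step_integral big_sumType.
have VE t w j : step_value lo hi c t w j =
    tnth (simple_value H t w) j + tnth (simple_value K t w) j.
  by rewrite !tnth_mktuple /step_value big_sumType.
under eq_integral do rewrite SE.
rewrite (step_isometry fW adm); apply: lee_wpmul2l.
  by rewrite lee_fin normal_sqr_moment_ge0.
have mH := simple_value_measurable aH; have mK := simple_value_measurable aK.
apply: iterated_integral_le.
- by move=> t w; exact: dotp_ge0.
- by move=> t w; exact: dotp_ge0.
- by move=> t w; apply: sumr_ge0 => j _; rewrite sqr_ge0.
- exact: sqr_subv_measurable.
- exact: sqr_subv_measurable.
- apply: measurable_sum => j; apply: measurable_funX.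
  rewrite (_ : (fun _ => _) = fun p : R * Omega =>
    tnth (simple_value H p.1 p.2) j + tnth (simple_value K p.1 p.2) j).
    exact: measurable_funD.
  by apply/funext => p; rewrite VE.
move=> t w tT; rewrite !mulr_sumr -big_split/=; apply: ler_sum => j _.
rewrite VE (UV _ _ tT) !tnth_mktuple.
move: (\sum_(i < _) _) (\sum_(i < _) _) (tnth (V t w) j) => x y z.
(* This is (p + q)^2 <= 2 p^2 + 2 q^2 with p = H - U and q = K - V; here z is the coordinate of V,
   and that of U is -z. *)
by have := sqr_ge0 (y + z - (x - z)); nra.
Qed.

(** The sum of the limits is the sum of the two simple integrals minus the two approximation errors.
    All of these are small in mean square, the simple part by the isometry. *)
Lemma ito_integral_opp U V MU MV :
  (forall t w, 0 <= t <= T -> U t w = oppv (V t w)) ->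
  ito_integral P G T W U MU -> ito_integral P G T W V MV ->
  {ae P, forall w, MU T w + MV T w = 0}.
Proof.
move=> UV iU iV.
have mU := ito_measurable iU; have mV := ito_measurable iV.
have [jU _ _ _ [Hn [aH eH limH]]] := iU.
have [jV _ _ _ [Kn [aK eK limK]]] := iV.
have TT : 0 <= T <= T by rewrite T0 lexx.
have {}limH := limH _ TT; have {}limK := limK _ TT.
have mN : measurable_fun setT (fun w => MU T w + MV T w) by exact: measurable_funD.
pose ka := normal_sqr_moment R; have ka0 : 0 <= ka := normal_sqr_moment_ge0 R.
have N0 : (\int[P]_w ((MU T w + MV T w) ^+ 2)%:E = 0)%E.
  apply/eqP; rewrite eq_le integral_ge0 ?andbT; last first.
    by move=> w _; rewrite lee_fin sqr_ge0.
  apply/lee_addgt0Pr => e e0; rewrite add0e.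
  (* Two nested uses of (x + y)^2 <= 2 x^2 + 2 y^2 leave 8 ka dl from the simple integrals and 8 dl
     from the limit errors, e in total. The 1 added to ka also keeps the denominator positive. *)
  pose dl := e / (8 * (ka + 1)).
  have dl0 : 0 < dl by rewrite divr_gt0// mulr_gt0// ltr_wpDl.
  have [n1 H1] := cvge0_lt eH dl0.
  have [n2 H2] := cvge0_lt eK dl0.
  have [n3 H3] := cvge0_lt limH dl0.
  have [n4 H4] := cvge0_lt limK dl0.
  pose n := maxn (maxn n1 n2) (maxn n3 n4).
  have h1 := H1 n (leq_trans (leq_maxl _ _) (leq_maxl _ _)).
  have h2 := H2 n (leq_trans (leq_maxr _ _) (leq_maxl _ _)).
  have h3 := H3 n (leq_trans (leq_maxl _ _) (leq_maxr _ _)).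
  have h4 := H4 n (leq_trans (leq_maxr _ _) (leq_maxr _ _)).
  have mSH : measurable_fun setT (simple_integral W (Hn n) T).
    rewrite simple_integralE//.
    exact: (measurable_step_integral fW (simple_admissibleS (aH n))).
  have mSK : measurable_fun setT (simple_integral W (Kn n) T).
    rewrite simple_integralE//.
    exact: (measurable_step_integral fW (simple_admissibleS (aK n))).
  have mD1 : measurable_fun setT (fun w => simple_integral W (Hn n) T w - MU T w).
    exact: measurable_funB.
  have mD2 : measurable_fun setT (fun w => simple_integral W (Kn n) T w - MV T w).
    exact: measurable_funB.
  have le1 := integral_sqrD_le P mD1 mD2.
  have le2 := simple_sum_isometry jU jV UV (aH n) (aK n).
  have mS : measurable_fun setT
      (fun w => simple_integral W (Hn n) T w + simple_integral W (Kn n) T w).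
    exact: measurable_funD.
  have mD : measurable_fun setT (fun w => - 1 *
      ((simple_integral W (Hn n) T w - MU T w) + (simple_integral W (Kn n) T w - MV T w))).
    by apply: measurable_funM => //; exact: measurable_funD.
  have := integral_sqrD_le P mS mD.
  rewrite (eq_integral (fun w => ((MU T w + MV T w) ^+ 2)%:E)); last first.
    by move=> w _; congr (_ ^+ 2)%:E; ring.
  rewrite (eq_integral (fun w => ((simple_integral W (Hn n) T w - MU T w +
    (simple_integral W (Kn n) T w - MV T w)) ^+ 2)%:E) (fun w => ((-1 * _) ^+ 2)%:E));
    last by move=> w _; rewrite mulN1r sqrrN.
  move=> /le_trans; apply.
  have ge02 : (0 <= 2%:E :> \bar R)%E by rewrite lee_fin.
  have b1 : (\int[P]_w ((simple_integral W (Hn n) T w +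
      simple_integral W (Kn n) T w) ^+ 2)%:E <= (ka * (2 * dl + 2 * dl))%:E)%E.
    apply: (le_trans le2); rewrite -[leRHS]/(ka%:E * (2%:E * dl%:E + 2%:E * dl%:E))%E.
    apply: lee_wpmul2l.
      by rewrite lee_fin.
    exact: (leeD (lee_wpmul2l ge02 (ltW h1)) (lee_wpmul2l ge02 (ltW h2))).
  have b2 : (\int[P]_w ((simple_integral W (Hn n) T w - MU T w +
      (simple_integral W (Kn n) T w - MV T w)) ^+ 2)%:E <= (2 * dl + 2 * dl)%:E)%E.
    apply: (le_trans le1); rewrite -[leRHS]/(2%:E * dl%:E + 2%:E * dl%:E)%E.
    exact: (leeD (lee_wpmul2l ge02 (ltW h3)) (lee_wpmul2l ge02 (ltW h4))).
  have -> : e%:E = (2%:E * (ka * (2 * dl + 2 * dl))%:E + 2%:E * (2 * dl + 2 * dl)%:E)%E.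
    rewrite -!EFinM -EFinD; congr EFin; rewrite /dl; field.
    by rewrite gt_eqF// ltr_wpDl.
  exact: (leeD (lee_wpmul2l ge02 b1) (lee_wpmul2l ge02 b2)).
have mN2 : measurable_fun setT (fun w => ((MU T w + MV T w) ^+ 2)%:E).
  by apply/measurable_EFinP; exact: measurable_funX.
have : ae_eq P setT (fun w => ((MU T w + MV T w) ^+ 2)%:E) (cst 0%E).
  apply/(ae_eq_integral_abs _ measurableT mN2).
  by under eq_integral do rewrite gee0_abs ?lee_fin ?sqr_ge0//.
apply: filterS => w /(_ I) /= [/eqP]; rewrite sqrf_eq0 => /eqP.
exact.
Qed.

End ito.

(** * The estimator *)

Section driving.
Context {R : realType} {d} {Omega : measurableType d} (P : probability Omega R).
Context (T : R) (n k l : nat) (mu : probability (n.-tuple R) R).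
Context (X0 : Omega -> n.-tuple R) (B : R -> Omega -> k.-tuple R)
  (W : R -> Omega -> l.-tuple R).
Hypothesis dn : driving_noise P T mu X0 B W.
Local Notation sX0 := (preimage_set_system setT X0 measurable).

Lemma driving_filtered_brownian1 :
  filtered_brownian P T B (fun t => augment P
    (sX0 `|` <<s history W T >> `|` history B t)).
Proof.
apply: (enlarged_filtration (dn_brownian1 dn)).
- by apply: preimage_set_system_sub; exact: (dn_X0_measurable dn).
- exact: (gen_history_measurable (dn_brownian2 dn)).
- exact: preimage_set_system_setI_closed.
- exact: sigma_algebra_setI_closed.
- exact: preimage_set_systemT.
- exact: (@measurableT _ (g_sigma_algebraType (history W T))).
- move=> A1 A2 A3 a1 a2 a3; rewrite setIAC muleAC.
  exact: (mutually_independent3 (dn_independent dn)).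
Qed.

(** The same enlargement with the roles exchanged, for integrals against W whose integrands also
    depend on X0 and B. *)
Lemma driving_filtered_brownian2 :
  filtered_brownian P T W (fun t => augment P
    (sX0 `|` <<s history B T >> `|` history W t)).
Proof.
apply: (enlarged_filtration (dn_brownian2 dn)).
- by apply: preimage_set_system_sub; exact: (dn_X0_measurable dn).
- exact: (gen_history_measurable (dn_brownian1 dn)).
- exact: preimage_set_system_setI_closed.
- exact: sigma_algebra_setI_closed.
- exact: preimage_set_systemT.
- exact: (@measurableT _ (g_sigma_algebraType (history B T))).
- exact: (mutually_independent3 (dn_independent dn)).
Qed.

Lemma forward_filtration_sub1 t : 0 <= t <= T ->
  forward_filtration P X0 B W t `<=`
  augment P (sX0 `|` <<s history W T >> `|` history B t).
Proof.
move=> /andP[_ tT]; apply: augmentS => A [[a|a]|a].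
- by left; left.
- by right.
- by left; right; apply: sub_sigma_algebra; exact: (history_mono tT).
Qed.

Lemma forward_filtration_sub2 t : 0 <= t <= T ->
  forward_filtration P X0 B W t `<=`
  augment P (sX0 `|` <<s history B T >> `|` history W t).
Proof.
move=> /andP[_ tT]; apply: augmentS => A [[a|a]|a].
- by left; left.
- by left; right; apply: sub_sigma_algebra; exact: (history_mono tT).
- by right.
Qed.

(** As t is arbitrary, the whole path of W up to T is already known at t = 0; this is the instance
    that serves for conditioning. *)
Lemma own_filtration_sub t :
  own_filtration P W T `<=`
  augment P (sX0 `|` <<s history W T >> `|` history B t).
Proof. by apply: augmentS => A a; left; right; exact: sub_sigma_algebra. Qed.

End driving.

Lemma integrable_ae_eq {R : realType} {d} {Omega : measurableType d}
    (P : probability Omega R) (X Y : Omega -> R) :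
  measurable_fun setT Y -> {ae P, forall w, X w = Y w} ->
  P.-integrable setT (EFin \o X) -> P.-integrable setT (EFin \o Y).
Proof.
move=> mY XY iX; have mX := integrable_measurable iX.
apply/integrableP; split; first exact/measurable_EFinP.
move: iX => /integrableP[_]; congr (_ < _)%E; apply: ge0_ae_eq_integral => //.
- by apply: measurableT_comp => //; exact/measurable_EFinP.
- by apply: measurableT_comp => //; exact/measurable_EFinP.
- by apply: filterS XY => w XYw _ /=; rewrite XYw.
Qed.

Theorem lemma3p3 (R : realType) (n m : nat) (T sigma : R)
    (hT : 0 < T) (hsigma : 0 < sigma)
    (mu : probability (n.-tuple R) R)
    (b : n.-tuple R -> n.-tuple R) (h : n.-tuple R -> m.-tuple R)
    (f : n.-tuple R -> R)
    (hb : measurable_fun setT b) (hh : measurable_fun setT h)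
    (hf : measurable_fun setT f)
    (* the filtering model and its filtering distribution *)
    (d0 : measure_display) (Omega0 : measurableType d0)
    (P0 : probability Omega0 R)
    (B0 : R -> Omega0 -> n.-tuple R) (W0 : R -> Omega0 -> m.-tuple R)
    (X0 : R -> Omega0 -> n.-tuple R) (Z0 : R -> Omega0 -> m.-tuple R)
    (hmodel : filtering_model P0 T mu b h sigma B0 W0 X0 Z0)
    (pi : R -> (R -> m.-tuple R) -> probability (n.-tuple R) R)
    (hpi : filtering_distribution P0 T X0 Z0 pi)
    (* the forward-backward system under P^* *)
    (d : measure_display) (Omega : measurableType d)
    (P : probability Omega R)
    (B : R -> Omega -> n.-tuple R) (I : R -> Omega -> m.-tuple R)
    (X : R -> Omega -> n.-tuple R) (D : R -> Omega -> R)
    (hbar : R -> Omega -> m.-tuple R)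
    (hforward : forward_system P T mu b h sigma B I X D hbar)
    (hrepr : filter_represented P T I X D (observation I hbar) pi)
    (Y : R -> Omega -> R) (Q : R -> Omega -> n.-tuple R)
    (V : R -> Omega -> m.-tuple R)
    (hterminal : P.-integrable setT (fun w => (D T w * f (X T w))%:E))
    (hbackward : bsde_solution P (forward_filtration P (X 0) B I) T B I hbar
       (fun w => D T w * f (X T w)) Y Q V)
    (* the control U and the stochastic integral J of U against Z *)
    (U : R -> Omega -> m.-tuple R)
    (hU : forall t w, 0 <= t <= T -> U t w = oppv (V t w))
    (J : R -> Omega -> R)
    (hJ : ito_process_integral P (forward_filtration P (X 0) B I) T I hbar U J) :
  is_cexp P (own_filtration P I T)
    (fun w => Y 0 w - J T w)
    (fun w => \int[pi T (observation I hbar ^~ w)]_x f x).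
Proof.
have T0 : 0 <= T by exact: ltW.
have TT : 0 <= T <= T by rewrite T0 lexx.
have OT : 0 <= (0 : R) <= T by rewrite lexx T0.
have dn := fs_noise hforward.
have fB := driving_filtered_brownian1 dn.
have fI := driving_filtered_brownian2 dn.
have subB := @forward_filtration_sub1 R _ _ P T n n m (X 0) B I.
have subI := @forward_filtration_sub2 R _ _ P T n n m (X 0) B I.
have [aY _ [[M N] /= [iM [aN [MV iMV eN]]] eY] termY] := hbackward.
have [aJ [MU iMU eJ]] := hJ.
have opp := ito_integral_opp fI subI T0 hU iMU iMV.
have key : {ae P, forall w, D T w * f (X T w) - M T w = Y 0 w - J T w}.
  have eYT : {ae P, forall w, [/\ MU T w + MV T w = 0,
      Y T w = D T w * f (X T w) & Y T w = Y 0 w + M T w + N T w]}.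
    by apply: filterS3 opp termY (eY T TT).
  apply: filterS3 eYT (eN T TT) (eJ T TT) => w [UV0 YT YE] [iV NE] [iU JE].
  have UVE : \int[lebesgue_measure]_(s in `[0, T]) dotp (U s w) (hbar s w) =
      - \int[lebesgue_measure]_(s in `[0, T]) dotp (V s w) (hbar s w).
    rewrite -mulN1r -RintegralZl//; apply: eq_Rintegral => s.
    rewrite inE/= in_itv/= => sT; rewrite hU// mulN1r /dotp -sumrN.
    by apply: eq_bigr => j _; rewrite tnth_mktuple mulNr.
  rewrite -YT YE NE JE UVE; move/eqP: UV0; rewrite addr_eq0 => /eqP ->; ring.
have FTm : forward_filtration P (X 0) B I T `<=` measurable.
  by apply: subset_trans (fb_sub fB (lexx T)); exact: subB.
have F0m : forward_filtration P (X 0) B I 0 `<=` measurable.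
  by apply: subset_trans (fb_sub fB T0); exact: subB.
have mYJ : measurable_fun setT (fun w => Y 0 w - J T w).
  apply: measurable_funB.
  - exact: (measurable_wrt_measurable F0m (aY _ OT)).
  - exact: (measurable_wrt_measurable FTm (aJ _ TT)).
have ownB := @own_filtration_sub R _ _ P T n n m (X 0) B I 0.
have own_meas A : own_filtration P I T A -> measurable A.
  by move=> /ownB; exact: (fb_sub fB).
have condM A (oA : own_filtration P I T A) :=
  ito_integral_cond fB subB T0 (ownB A oA) iM.
(* The event is the whole space, and the integrability half of the conclusion is kept. *)
have iMT := (condM setT (@measurableT _ (g_sigma_algebraType _))).1.
have [iDf ipi mpi Epi] := hrepr T TT f hf hterminal.
have iDM := integrableRB hterminal iMT.
split=> //; first exact: integrable_ae_eq mYJ key iDM.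
move=> A oA; rewrite Epi//; have mA := own_meas _ oA.
have iA X' : P.-integrable setT (EFin \o X') -> P.-integrable A (EFin \o X').
  by move=> iX'; exact: integrableS iX'.
(* [Epi] has replaced the filter by D_T f(X_T). Subtracting M_T leaves its integral over A unchanged
   and produces the left side of [key]. *)
transitivity (\int[P]_(w in A) (D T w * f (X T w) - M T w)%:E)%E.
  under [RHS]eq_integral do rewrite EFinB.
  rewrite integralB_EFin//; [|exact: iA|exact: iA].
  suff -> : (\int[P]_(w in A) (M T w)%:E = 0)%E by rewrite sube0.
  have fM := integrable_fin_num mA (iA _ iMT).
  rewrite -(fineK fM); congr EFin; rewrite -[LHS]/(\int[P]_(w in A) M T w).
  rewrite -[RHS](condM A oA).2 Rintegral_mkcond; apply: eq_Rintegral => w _.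
  by rewrite patchE indicE; case: (w \in A); rewrite ?mul1r ?mul0r.
apply: ae_eq_integral => //.
- by apply: measurable_funTS; exact: (measurable_int P).
- by apply: measurable_funTS; exact/measurable_EFinP.
- by apply: filterS key => w -> .
Qed.
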